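(* The cluster complex of any skew-symmetric cluster algebra (with coefficients in an arbitrary semifield) only depends on its defining matrix. That is, if $\mathcal A(\mathbf x,\mathbf y,B)$ and $\mathcal A(\mathbf x',\mathbf y',B)$ are cluster algebras over semifields $\mathbb P$ and $\mathbb P'$ respectively, with the same skew-symmetric integer matrix $B$ in their initial seeds, then their cluster complexes are isomorphic simplicial complexes.
   Context: Cluster algebras with arbitrary coefficients (Fomin–Zelevinsky). Let $(\mathbb{P},\oplus,\cdot)$ be a semifield: an abelian multiplicative group with a commutative, associative addition $\oplus$ over which multiplication distributes. Let $\mathbb{Z}\mathbb{P}$ be the group ring of its multiplicative group, $\mathbb{Q}\mathbb{P}$ the fraction field of $\mathbb{Z}\mathbb{P}$, and $\mathcal{F}$ a field of rational functions in $m$ variables over $\mathbb{Q}\mathbb{P}$. A seed is a triple $(\mathbf{x},\mathbf{y},B)$ where $\mathbf x=(x_1,\dots,x_m)$ is a free generating set of $\mathcal F$ over $\mathbb{Q}\mathbb{P}$ (the cluster), $\mathbf y=(y_1,\dots,y_m)$ is a tuple in $\mathbb{P}$, and $B=(b_{ij})$ is a skew-symmetric integer $m\times m$ matrix. Write $[z]_+=\max(z,0)$. The mutation at $k$ replaces $(\mathbf x,\mathbf y,B)$ by $(\mathbf x',\mathbf y',B')$ with: $b'_{ij}=-b_{ij}$ if $i=k$ or $j=k$ and $b'_{ij}=b_{ij}+\frac{b_{ik}|b_{kj}|+|b_{ik}|b_{kj}}{2}$ otherwise; $y'_k=y_k^{-1}$ and $y'_j=y_jy_k^{[b_{kj}]_+}(y_k\oplus1)^{-b_{kj}}$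 for $j\ne k$; $x'_j=x_j$ for $j\neq k$ and $$x'_k=\frac{y_k\prod_i x_i^{[b_{ik}]_+}+\prod_i x_i^{[-b_{ik}]_+}}{(y_k\oplus1)\,x_k}.$$ Fix an initial seed $(\mathbf x,\mathbf y,B)$; its matrix $B$ is the defining matrix. The clusters of $\mathcal A(\mathbf x,\mathbf y,B)$ are the clusters (viewed as sets) of seeds obtained from the initial seed by iterated mutations, cluster variables are the elements of clusters, and $\mathcal A(\mathbf x,\mathbf y,B)$ is the $\mathbb{Z}\mathbb{P}$-subalgebra of $\mathcal F$ generated by all cluster variables. The cluster complex of a cluster algebra is the simplicial complex whose set of vertices is the set of cluster variables and whose simplices are the subsets of clusters. *)

(* Defs.v *)
From HB Require Import structures.
From mathcomp Require Import all_boot all_order all_algebra.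
From mathcomp Require Import finmap monalg.
From mathcomp Require mpoly.
From mathcomp Require Import boolp classical_sets functions.

Set Implicit Arguments.
Unset Strict Implicit.
Unset Printing Implicit Defensive.

Import Order.TTheory GRing.Theory Num.Theory.

Local Open Scope ring_scope.

(* Semifields have no zero: the multiplicative structure is a group. *)
HB.mixin Record Group_isSemifield P of Group P := {
  mulgC : forall x y : P, (x * y = y * x)%g;
  oplus : P -> P -> P;
  oplusA : associative oplus;
  oplusC : commutative oplus;
  mulg_oplusr : forall x y z : P, (x * oplus y z = oplus (x * y) (x * z))%g
}.

#[short(type="semifieldType")]
HB.structure Definition Semifield := {P of Group_isSemifield P & Group P}.

Notation "x (+) y" := (oplus x y) : group_scope.

Definition expgz (G : groupType) (g : G) (z : int) : G :=
  match z with Posz n => (g ^+ n)%g | Negz n => (g ^- n.+1)%g end.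

Section SemifieldTheory.
Variable P : semifieldType.
Implicit Types x y : P.

Fixpoint geomsum x n : P :=
  if n is n'.+1 then (geomsum x n' (+) x ^+ n)%g else 1%g.

Lemma mulg_geomsum x n :
  ((x * geomsum x n) (+) 1 = geomsum x n (+) x ^+ n.+1)%g.
Proof.
elim: n => [|n IHn]; first by rewrite /= mulg1 expg1 oplusC.
rewrite [geomsum _ _]/= mulg_oplusr -expgS -oplusA [X in oplus _ X]oplusC oplusA.
by rewrite IHn.
Qed.

Lemma semifield_torsionfree x n : (x ^+ n.+1 = 1)%g -> x = 1%g.
Proof.
case: n => [|n] xn1; first by rewrite -xn1 expg1.
apply: (@mulIg _ (geomsum x n.+1)); rewrite mul1g /= mulg_oplusr -expgS xn1.
exact: mulg_geomsum.
Qed.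

Let cone (C : P -> Prop) :=
  ~ C 1%g /\ forall x y, C x -> C y -> C (x * y)%g.

Let cone1 (C : P -> Prop) x := x = 1%g \/ C x.

Let cone1M C x y : cone C -> cone1 C x -> cone1 C y -> cone1 C (x * y)%g.
Proof.
move=> [_ CM] [->|Cx] [->|Cy]; rewrite ?mul1g ?mulg1;
  by [left | right | right; apply: CM].
Qed.

Let coneX (C : P -> Prop) x n : cone C -> C x -> C (x ^+ n.+1)%g.
Proof.
by move=> [_ CM] Cx; elim: n => [|n IHn]; [rewrite expg1 | rewrite expgS; apply: CM].
Qed.

Let cone_add C a : cone C ->
    (forall c n, cone1 C c -> (c * a ^+ n.+1)%g <> 1%g) ->
  exists C', [/\ cone C', forall x, C x -> C' x & C' a].
Proof.
move=> coneC aP; have [C1 CM] := coneC.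
exists (fun x => C x \/ exists c n, cone1 C c /\ x = (c * a ^+ n.+1)%g); split.
- split; first by case=> // -[c [n [Cc /esym]]]; apply: aP.
  move=> x y [Cx|[c [n [Cc ->]]]] [Cy|[d [k [Cd ->]]]].
  + by left; apply: CM.
  + right; exists (x * d)%g, k; split; last by rewrite mulgA.
    by apply: cone1M => //; right.
  + right; exists (c * y)%g, n; split; first by apply: cone1M => //; right.
    by rewrite mulgC mulgA [(y * c)%g]mulgC.
  + right; exists (c * d)%g, (n + k.+1)%N; split; first exact: cone1M.
    rewrite -addSn expgnDr !mulgA; congr (_ * _)%g.
    by rewrite -!mulgA; congr (_ * _)%g; rewrite mulgC.
- by left.
- by right; exists 1%g, 0%N; split; [left | rewrite mul1g expg1].
Qed.

Let cone_sign C a : cone C -> a <> 1%g ->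
  exists C', [/\ cone C', forall x, C x -> C' x & C' a \/ C' a^-1%g].
Proof.
move=> coneC a1; have [C1 CM] := coneC.
have [[c [n [Cc can]]]|aP] :=
  pselect (exists c n, cone1 C c /\ (c * a ^+ n.+1 = 1)%g); last first.
  have [|C' [C'c C'C C'a]] := @cone_add C a coneC.
    by move=> c n Cc can; apply: aP; exists c, n.
  by exists C'; split => //; left.
have [|C' [C'c C'C C'a]] := @cone_add C a^-1%g coneC; last first.
  by exists C'; split => //; right.
move=> d k Cd dak.
have Cc' : C c.
  by case: Cc can => [->|//]; rewrite mul1g => /semifield_torsionfree.
have dE : d = (a ^+ k.+1)%g.
  by apply: (@mulIg _ (a^-1 ^+ k.+1)%g); rewrite dak expVgn mulgV.
have Cd' : C d.
  by case: Cd => // d1; move: dE; rewrite d1 => /esym/semifield_torsionfree.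
have cE : c = (a ^- n.+1)%g.
  by apply: (@mulIg _ (a ^+ n.+1)%g); rewrite can mulVg.
apply: C1; rewrite -(mulgV ((a ^+ k.+1) ^+ n.+1)%g); apply: CM.
  by rewrite -dE; apply: coneX.
by rewrite -expgnA mulnC expgnA -expVgn -cE; apply: coneX.
Qed.

Lemma exists_cone (s : seq P) : exists C, cone C /\
  forall a, a \in s -> a <> 1%g -> C a \/ C a^-1%g.
Proof.
elim: s => [|a s [C [Cc Cs]]]; first by exists (fun _ => False); split=> //; split.
have [->|/eqP a1] := eqVneq a 1%g.
  by exists C; split=> // b; rewrite in_cons => /orP[/eqP->//|]; apply: Cs.
have [C' [C'c CC' C'a]] := cone_sign Cc a1; exists C'; split=> // b.
rewrite in_cons => /orP[/eqP-> //|bs b1].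
by case: (Cs b bs b1) => /CC'; [left | right].
Qed.

Let cone_max C (s : seq P) x0 : cone C ->
    (forall x y, x \in s -> y \in s -> x <> y -> C (x / y)%g \/ C (y / x)%g) ->
  x0 \in s -> exists2 m, m \in s & forall x, x \in s -> x <> m -> C (m / x)%g.
Proof.
move=> [_ CM]; elim: s x0 => [//|a s IHs] x0 tot _.
have [s0|[b bs]] : s = [::] \/ exists b, b \in s.
  by case: s {IHs tot} => [|b s]; [left | right; exists b; rewrite mem_head].
  exists a; rewrite ?mem_head // => x; rewrite s0 mem_seq1 => /eqP->.
  by move=> /(_ erefl).
have [|m ms mP] := IHs b _ bs.
  by move=> x y xs ys; apply: tot; rewrite in_cons ?xs ?ys orbT.
have [am|/eqP am] := eqVneq a m.
  exists m; first by rewrite in_cons ms orbT.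
  by move=> x; rewrite in_cons => /orP[/eqP->//|]; apply: mP.
have [||Cam|Cma] := tot a m _ _ am; rewrite ?mem_head ?in_cons ?ms ?orbT //.
  exists a; first by rewrite mem_head.
  move=> x; rewrite in_cons => /orP[/eqP-> //|xs _].
  have [->//|/eqP xm] := eqVneq x m.
  by rewrite -(mulgVK m a) -mulgA; apply: CM => //; apply: mP.
exists m; first by rewrite in_cons ms orbT.
by move=> x; rewrite in_cons => /orP[/eqP->//|]; apply: mP.
Qed.

(* Unique product property of the (torsion-free abelian) group P. *)
Lemma unique_product (s t : seq P) x0 y0 : x0 \in s -> y0 \in t ->
  exists a b, [/\ a \in s, b \in t &
    forall x y, x \in s -> y \in t -> (x * y = a * b)%g -> x = a /\ y = b].
Proof.
move=> xs yt; pose r := [seq (x / y)%g | x <- s ++ t, y <- s ++ t].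
have [C [coneC Cr]] := exists_cone r; have [C1 CM] := coneC.
have tot x y : x \in s ++ t -> y \in s ++ t -> x <> y ->
    C (x / y)%g \/ C (y / x)%g.
  move=> xst yst xy; rewrite -[(y / x)%g]invgK invgM invgK.
  apply: Cr; first exact: allpairs_f.
  by move=> xy1; apply: xy; rewrite -(mulgVK y x) xy1 mul1g.
have [|a as_ aP] := @cone_max C s x0 coneC _ xs.
  by move=> x y xs' ys'; apply: tot; rewrite mem_cat ?xs' ?ys'.
have [|b bt bP] := @cone_max C t y0 coneC _ yt.
  by move=> x y xs' ys'; apply: tot; rewrite mem_cat ?xs' ?ys' orbT.
exists a, b; split=> // x y xs' yt' xyab.
have abxy : (a / x = y / b)%g.
  have -> : y = (x^-1 * (a * b))%g by rewrite -xyab mulKg.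
  by rewrite mulgA mulgK mulgC.
have [xa|/eqP xa] := eqVneq x a.
  by split=> //; move: xyab; rewrite xa => /mulgI.
have [yb|/eqP yb] := eqVneq y b.
  by split=> //; move: xyab; rewrite yb => /mulIg.
exfalso; apply: C1; rewrite -(mulgV (a / x)%g); apply: CM; first exact: aP.
by rewrite abxy invgM invgK; apply: bP.
Qed.

End SemifieldTheory.

Definition group_ring (P : semifieldType) : Type := {malg int[P]}.

Section GroupRing.
Variable P : semifieldType.
Implicit Types (g h : group_ring P) (x y : P).

Local Open Scope fset_scope.
Local Notation supp := (@monalg.msupp P int).
Local Notation coeff := (@monalg.mcoeff P int).

HB.instance Definition _ := GRing.Zmodule.on (group_ring P).

Definition group_ring_of x : group_ring P := mkmalgU x (1 : int).

Definition group_ring_mul g h : group_ring P :=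
  \sum_(x <- supp g) \sum_(y <- supp h)
    mkmalgU (x * y)%g (coeff x g * coeff y h).

Local Notation "g *z h" := (group_ring_mul g h) (at level 40).

Lemma group_ring_mulw (d1 d2 : {fset P}) g h :
  supp g `<=` d1 -> supp h `<=` d2 ->
  g *z h = \sum_(x <- d1) \sum_(y <- d2) mkmalgU (x * y)%g (coeff x g * coeff y h).
Proof.
move=> le1 le2; rewrite /group_ring_mul (big_fset_incl _ le1) /=.
  apply/eq_bigr=> x _; apply/big_fset_incl => // y _ /mcoeff_outdom ->.
  by rewrite mulr0 monalgU0.
move=> x _ /mcoeff_outdom gx.
by rewrite big1 => // y _; rewrite gx mul0r monalgU0.
Qed.

Lemma group_ring_mulC : commutative group_ring_mul.
Proof.
move=> g h; rewrite /group_ring_mul exchange_big /=.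
by apply: eq_bigr => y _; apply: eq_bigr => x _; rewrite mulgC mulrC.
Qed.

Lemma group_ring_mulDl : left_distributive group_ring_mul +%R.
Proof.
move=> g1 g2 h; have hh := fsubset_refl (supp h).
rewrite (group_ring_mulw (msuppD_le _ _) hh).
rewrite (group_ring_mulw (fsubsetUl _ (supp g2)) hh).
rewrite (group_ring_mulw (fsubsetUr (supp g1) _) hh).
rewrite -big_split /=; apply/eq_bigr=> x _.
rewrite -big_split /=; apply/eq_bigr=> y _.
by rewrite mcoeffD mulrDl monalgUD.
Qed.

Lemma group_ring_mul0 : left_zero 0 group_ring_mul.
Proof. by move=> h; rewrite /group_ring_mul msupp0 big_seq_fset0. Qed.

Lemma group_ring_mulUU x y a b :
  mkmalgU x a *z mkmalgU y b = mkmalgU (x * y)%g (a * b).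
Proof. by rewrite (group_ring_mulw msuppU_le msuppU_le) !big_seq_fset1 !mcoeffUU. Qed.

Lemma group_ring_mul_suml (I : Type) (r : seq I) (E : I -> group_ring P) h :
  (\sum_(i <- r) E i) *z h = \sum_(i <- r) (E i *z h).
Proof.
exact: (big_morph (group_ring_mul^~ h)
  (fun _ _ => group_ring_mulDl _ _ _) (group_ring_mul0 _)).
Qed.

Lemma group_ring_mul_sumr (I : Type) (r : seq I) (E : I -> group_ring P) h :
  h *z (\sum_(i <- r) E i) = \sum_(i <- r) (h *z E i).
Proof.
rewrite group_ring_mulC group_ring_mul_suml.
by apply: eq_bigr => i _; rewrite group_ring_mulC.
Qed.

Lemma group_ring_mulA : associative group_ring_mul.
Proof.
move=> g1 g2 g3.
rewrite [g1]monalgE (group_ring_mul_suml _ _ (g2 *z g3)).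
rewrite (group_ring_mul_suml _ _ g2) (group_ring_mul_suml _ _ g3).
apply: eq_bigr => x _; set a := mkmalgU x _.
rewrite [g2]monalgE (group_ring_mul_suml _ _ g3) !(group_ring_mul_sumr _ _ a).
rewrite (group_ring_mul_suml _ _ g3); apply: eq_bigr => y _.
set b := mkmalgU y _; rewrite [g3]monalgE (group_ring_mul_sumr _ _ b).
rewrite (group_ring_mul_sumr _ _ a) (group_ring_mul_sumr _ _ (a *z b)).
apply: eq_bigr => z _.
by rewrite !group_ring_mulUU mulgA mulrA.
Qed.

Lemma group_ring_mul1 : left_id (group_ring_of 1%g) group_ring_mul.
Proof.
move=> g; rewrite [g]monalgE group_ring_mul_sumr; apply: eq_bigr => x _.
by rewrite group_ring_mulUU mul1g mul1r.
Qed.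

Lemma group_ring_oner_neq0 : group_ring_of 1%g != 0.
Proof. by rewrite monalgU_eq0. Qed.

HB.instance Definition _ := GRing.Zmodule_isComNzRing.Build (group_ring P)
  group_ring_mulA group_ring_mulC group_ring_mul1 group_ring_mulDl
  group_ring_oner_neq0.

Lemma group_ring_coeffM g h z : coeff z (g * h) =
  \sum_(x <- supp g) \sum_(y <- supp h | (x * y == z)%g) coeff x g * coeff y h.
Proof.
have -> : g * h = g *z h by [].
rewrite /group_ring_mul raddf_sum; apply: eq_bigr => x _.
rewrite raddf_sum [RHS]big_mkcond; apply: eq_bigr => y _ /=.
by rewrite mcoeffU; case: (_ == _).
Qed.

Lemma group_ring_mulf_eq0 : GRing.integral_domain_axiom (group_ring P).
Proof.
move=> g h gh0; apply/norP => -[].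
have suppN0 f : f != 0 -> exists x, x \in supp f.
  move=> f0; apply/fset0Pn; apply: contraNneq f0 => suppf.
  by rewrite [f]monalgE suppf big_seq_fset0.
move=> /suppN0[x0 gx0] /suppN0[y0 hy0].
have [a [b [ga hb ab_uniq]]] := unique_product gx0 hy0.
have /eqP := group_ring_coeffM g h (a * b)%g.
rewrite gh0 mcoeff0 eq_sym (big_fsetD1 a) //= [X in (_ + X)%R]big1_fset; last first.
  move=> x; rewrite in_fsetD1 => /andP[/eqP xa gx] _.
  rewrite big_seq_cond big1 // => y /andP[hy /eqP xy].
  by have [] := ab_uniq x y gx hy xy.
rewrite addr0 big_mkcond (big_fsetD1 b) //= eqxx [X in (_ + X)%R]big1_fset; last first.
  move=> y; rewrite in_fsetD1 => /andP[/eqP yb hy] _.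
  by case: eqP => // ay; have [] := ab_uniq a y ga hy ay.
by rewrite addr0 mulf_eq0 !mcoeff_eq0 ga hb.
Qed.


Definition group_ring_unit g := `[< exists h, h * g = 1 >].

Definition group_ring_inv g : group_ring P :=
  if pselect (exists h, h * g = 1) is left e then projT1 (cid e) else g.

Lemma group_ring_mulVr : {in group_ring_unit, left_inverse 1 group_ring_inv *%R}.
Proof.
move=> g /asboolP gU; rewrite /group_ring_inv; case: pselect => // e.
by case: cid.
Qed.

Lemma group_ring_unitP g h : h * g = 1 -> group_ring_unit g.
Proof. by move=> hg; apply/asboolP; exists h. Qed.

Lemma group_ring_inv_out : {in [predC group_ring_unit], group_ring_inv =1 id}.
Proof.
by move=> g /asboolP gU; rewrite /group_ring_inv; case: pselect.
Qed.

HB.instance Definition _ := GRing.ComNzRing_hasMulInverse.Build (group_ring P)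
  group_ring_mulVr group_ring_unitP group_ring_inv_out.

HB.instance Definition _ := GRing.ComUnitRing_isIntegral.Build (group_ring P)
  group_ring_mulf_eq0.

End GroupRing.


(* Not imported earlier: mpoly and monalg share many names. *)
Import mpoly.

(* QP is the field of fractions of ZP. The ambient field F of a cluster
   algebra over P is presented by its structure map from QP. *)
Definition coeff_field (P : semifieldType) : fieldType :=
  {fraction group_ring P}.

Definition semifield_embed (P : semifieldType) (F : fieldType)
    (iota : {rmorphism coeff_field P -> F}) (p : P) : F :=
  iota (FracField.tofrac (group_ring_of p)).

(* x is algebraically independent over K, and F = K(x): in particular the
   existence of such an x makes F a field of rational functions over K. *)
Definition free_generating (K F : fieldType) (iota : {rmorphism K -> F})
    (m : nat) (x : 'I_m -> F) : Prop :=
  (forall p : mpoly.mpoly m K, mpoly.mmap iota x p = 0 -> p = 0) /\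
  (forall z : F, exists p q : mpoly.mpoly m K,
     mpoly.mmap iota x q != 0 /\ z = mpoly.mmap iota x p / mpoly.mmap iota x q).

Record seed (P : semifieldType) (F : fieldType) (m : nat) := Seed {
  seed_x : 'I_m -> F;
  seed_y : 'I_m -> P;
  seed_B : 'M[int]_m
}.

Definition is_seed (P : semifieldType) (F : fieldType)
    (iota : {rmorphism coeff_field P -> F}) (m : nat) (s : seed P F m) : Prop :=
  free_generating iota (seed_x s) /\ (seed_B s)^T = - seed_B s.

Definition pos_part (z : int) : int := Num.max z 0.

Section Mutation.
Variables (P : semifieldType) (F : fieldType).
Variable iota : {rmorphism coeff_field P -> F}.
Variables (m : nat) (s : seed P F m) (k : 'I_m).

Local Notation x := (seed_x s).
Local Notation y := (seed_y s).
Local Notation b := (seed_B s).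

(* The division by 2 is exact: the numerator is 0 or +-2 |b_ik b_kj|. *)
Definition mutate_B : 'M[int]_m :=
  \matrix_(i, j)
    if (i == k) || (j == k) then - b i j
    else b i j + ((b i k * `|b k j| + `|b i k| * b k j) %/ 2)%Z.

Definition mutate_y (j : 'I_m) : P :=
  if j == k then ((y k)^-1)%g
  else (y j * expgz (y k) (pos_part (b k j))
            * expgz (y k (+) 1) (- b k j)%R)%g.

Definition mutate_x (j : 'I_m) : F :=
  if j == k then
    (semifield_embed iota (y k) * \prod_(i < m) x i ^ pos_part (b i k)
       + \prod_(i < m) x i ^ pos_part (- b i k))
    / (semifield_embed iota (y k (+) 1)%g * x k)
  else x j.

Definition mutate : seed P F m := Seed mutate_x mutate_y mutate_B.

End Mutation.

Section ClusterComplex.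
Local Open Scope classical_set_scope.
Local Open Scope fset_scope.

Record simplicial_complex (V : choiceType) := SimplicialComplex {
  vertices : set V;
  simplex : set {fset V};
  simplex_vertices : forall S v, simplex S -> v \in S -> vertices v;
  simplex_vertex : forall v, vertices v -> simplex [fset v];
  simplex_sub : forall S T, simplex S -> T `<=` S -> simplex T
}.

Definition sc_isomorphic (V W : choiceType)
    (K : simplicial_complex V) (L : simplicial_complex W) : Prop :=
  exists phi : V -> W,
    set_bij (vertices K) (vertices L) phi /\
    forall S : {fset V}, (forall v, v \in S -> vertices K v) ->
      simplex K S <-> simplex L [fset phi v | v in S].

Variables (P : semifieldType) (F : fieldType).
Variable iota : {rmorphism coeff_field P -> F}.
Variables (m : nat) (s0 : seed P F m).

Definition mutation_equivalent (s : seed P F m) : Prop :=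
  exists ks : seq 'I_m, s = foldl (fun t k => mutate iota t k) s0 ks.

Definition is_cluster (C : {fset F}) : Prop :=
  exists2 s, mutation_equivalent s & C = [fset seed_x s i | i in 'I_m].

Definition is_cluster_variable (z : F) : Prop :=
  exists2 C, is_cluster C & z \in C.

Definition is_cluster_simplex (S : {fset F}) : Prop :=
  exists2 C, is_cluster C & S `<=` C.

Lemma cluster_simplex_vertices S v :
  is_cluster_simplex S -> v \in S -> is_cluster_variable v.
Proof. by move=> [C CC /fsubsetP SC] /SC vC; exists C. Qed.

Lemma cluster_simplex_vertex v :
  is_cluster_variable v -> is_cluster_simplex [fset v].
Proof. by move=> [C CC vC]; exists C => //; rewrite fsub1set. Qed.

Lemma cluster_simplex_sub S T :
  is_cluster_simplex S -> T `<=` S -> is_cluster_simplex T.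
Proof. by move=> [C CC SC] TS; exists C => //; apply: fsubset_trans SC. Qed.

Definition cluster_complex : simplicial_complex F :=
  SimplicialComplex cluster_simplex_vertices cluster_simplex_vertex
    cluster_simplex_sub.

End ClusterComplex.

(* Main.v *)
From HB Require Import structures.
From mathcomp Require Import all_boot all_order all_algebra.
From mathcomp Require Import finmap monalg.
From mathcomp Require mpoly classical_sets.
From mathcomp Require Import boolp.
From mathcomp Require Import ring zify.
Require Import Defs.

Set Implicit Arguments.
Unset Strict Implicit.
Unset Printing Implicit Defensive.

(** Index cluster variables by words in the mutation directions (the walk from the
    initial seed) and a position. The cluster complex is determined by which
    indices give equal cluster variables, so the theorem says that this relation
    depends on [B] only: an equality over one semifield of coefficients must
    imply the same equality over any other.

    Cluster variables are subtraction-free in the initial cluster and the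
    coefficients, and the semifield of subtraction-free elements has a universal
    property ([pf_ext]). So an equality over [P] implies the equality of the
    corresponding tropical functions on Z^m, computed with trivial coefficients
    ([specialize_eq]); these depend on [B] only.

    Conversely ([tropical_eq_generic]), let two tropical functions be equal, for
    the variables z in one seed and x_i in another seed s. Mutation is
    invertible, so s may be regarded as the initial seed. By the Laurent
    phenomenon, z is a Laurent polynomial in the cluster of s over the group ring
    of the coefficients. Its lowest and highest degrees in each variable of s are
    tropical values of z, hence are those of x_i ([expansion_degrees]); so
    z = f x_i, where f is an element of the group ring of the coefficients.
    Exchanging the roles of the two variables, x_i = f' z, so f is a unit of
    that group ring. The group being orderable, f is plus or minus an element p
    of the semifield ([group_ring_unit_monomial]), and z = p x_i by positivity.
    Finally the exchange relations are normalized so that the specialization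
    of the initial cluster to 1, with the coefficients kept and addition
    interpreted in the semifield, sends every cluster variable to 1 ([walk_one]);
    so p = 1.

    The Laurent phenomenon ([laurent_phenomenon]) is proved by induction on the
    length of the walk: a variable reached by a walk j, k, ... is a Laurent
    polynomial in the seeds reached by j and by j, k, j, from which it is closer,
    and the denominators of the two expressions in the initial cluster are
    coprime ([laurent_exchange]). Coprimality needs independent exponent vectors,
    so the argument is run with principal coefficients (a factor Z^m with its
    tropical addition) adjoined to the semifield, which are forgotten at the
    end ([free_eq_transfer]). *)

Import Order.TTheory GRing.Theory Num.Theory.

Local Open Scope group_scope.

Notation "x ^z n" := (expgz x n%R) (at level 30, n at level 29) : group_scope.
Notation ghom f := {morph f : x y / x * y}.

(** * Integer powers in the multiplicative group of a semifield *)

Section SemifieldPowers.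
Variable S : semifieldType.
Implicit Types (x y : S) (n p : int).

HB.instance Definition _ := SemiGroup.isCommutativeLaw.Build S (@monoid.mul S) (@mulgC S).

Lemma mulgCA x y z : x * (y * z) = y * (x * z).
Proof. by rewrite mulgA (mulgC x y) mulgA. Qed.

Lemma expgz0 x : x ^z 0 = 1.
Proof. by []. Qed.

Lemma expgz1 x : x ^z 1 = x.
Proof. by []. Qed.

Lemma expgzN x n : x ^z (- n) = (x ^z n)^-1.
Proof.
case: n => [[|n]|n]; rewrite ?oppr0 //=; first by rewrite expg0 invg1.
by rewrite invgK.
Qed.

Lemma expgzS x n : x ^z (n + 1) = x ^z n * x.
Proof.
case: n => [n|n]; first by rewrite -PoszD addn1 /= expgSr.
case: n => [|n]; first by rewrite /= expg1 mulVg.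
rewrite [X in expgz x X](_ : _ = Negz n) /=; last by lia.
by rewrite [x ^+ n.+2]expgS invgM mulgVK.
Qed.

Lemma expgzD x n p : x ^z (n + p) = x ^z n * x ^z p.
Proof.
elim/int_rec: p => [|p IHp|p IHp]; first by rewrite addr0 expgz0 mulg1.
- by rewrite -addn1 PoszD addrA !expgzS IHp mulgA.
- apply: (@mulIg _ x); rewrite -mulgA -!expgzS -addrA.
  by rewrite (_ : (- Posz p.+1 + 1 = - Posz p)%R) //; lia.
Qed.

Lemma exp1gz n : 1 ^z n = 1 :> S.
Proof. by case: n => n /=; rewrite expg1n ?invg1. Qed.

Lemma expgMz x y n : (x * y) ^z n = x ^z n * y ^z n.
Proof.
have E k : (x * y) ^+ k = x ^+ k * y ^+ k by apply: expgMn; apply: mulgC.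
by case: n => n /=; rewrite E // invgM mulgC.
Qed.

Lemma expVgz x n : x^-1 ^z n = (x ^z n)^-1.
Proof. by apply: (@mulIg _ (x ^z n)); rewrite -expgMz !mulVg exp1gz. Qed.

Lemma expgzM x n p : x ^z (n * p) = (x ^z n) ^z p.
Proof.
elim/int_rec: p => [|p IHp|p IHp]; first by rewrite mulr0 !expgz0.
- by rewrite -addn1 PoszD mulrDr mulr1 [LHS]expgzD IHp expgzS.
- rewrite -addn1 PoszD opprD mulrDr mulrN1 [LHS]expgzD IHp [RHS]expgzD.
  by rewrite !expgzN expgz1.
Qed.

Lemma prodgz (I : Type) (r : seq I) (Q : pred I) (E : I -> S) n :
  (\prod_(i <- r | Q i) E i) ^z n = \prod_(i <- r | Q i) (E i ^z n).
Proof.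
elim: r => [|i r IHr]; rewrite ?big_nil ?exp1gz // !big_cons; case: (Q i) => //.
by rewrite expgMz IHr.
Qed.

Lemma prodgzr (I : Type) (r : seq I) (Q : pred I) (E : I -> int) x :
  x ^z (\sum_(i <- r | Q i) E i)%R = \prod_(i <- r | Q i) (x ^z E i).
Proof.
elim: r => [|i r IHr]; rewrite ?big_nil // !big_cons; case: (Q i) => //.
by rewrite expgzD IHr.
Qed.

Lemma mulg_oplusl x y z : (x (+) y) * z = (x * z) (+) (y * z).
Proof. by rewrite mulgC mulg_oplusr ![z * _]mulgC. Qed.

End SemifieldPowers.

(** * Equations between monomials in an abelian group *)

(** Syntax for the tactic [abelian], which proves an equation between monomials
    with symbolic integer exponents by comparing the exponents of each atom. *)
Inductive gexp :=
  | GAtom of nat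
  | GOne
  | GMul of gexp & gexp
  | GInv of gexp
  | GExp of gexp & int.

Section GroupReflection.
Variables (S : semifieldType) (env : seq S).

Fixpoint gdenote e : S := match e with
  | GAtom i => nth 1 env i
  | GOne => 1
  | GMul e1 e2 => gdenote e1 * gdenote e2
  | GInv e1 => (gdenote e1)^-1
  | GExp e1 n => gdenote e1 ^z n
  end.

Fixpoint gcoef e i : int := match e with
  | GAtom j => (i == j)%:R
  | GOne => 0
  | GMul e1 e2 => gcoef e1 i + gcoef e2 i
  | GInv e1 => - gcoef e1 i
  | GExp e1 n => gcoef e1 i * n
  end%R.

Lemma gdenoteE e : gdenote e = \prod_(i < size env) (nth 1 env i) ^z gcoef e i.
Proof.
elim: e => [j||e1 IH1 e2 IH2|e1 IH1|e1 IH1 n] /=.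
- have [js|js] := ltnP j (size env); last first.
    rewrite nth_default // big1 // => i _.
    by case: eqP => //= ij; rewrite -ij leqNgt ltn_ord in js.
  rewrite (bigD1 (Ordinal js)) //= eqxx big1 ?mulg1 // => i ij.
  by case: eqP => // ij'; case/eqP: ij; apply: val_inj.
- by rewrite big1.
- by rewrite IH1 IH2 -big_split; apply: eq_bigr => i _; rewrite expgzD.
- rewrite IH1 -[_^-1]expgz1 expVgz -expgzN prodgz.
  by apply: eq_bigr => i _; rewrite -expgzM mulrN1.
- by rewrite IH1 prodgz; apply: eq_bigr => i _; rewrite expgzM.
Qed.

Fixpoint geq_upto e1 e2 n : Prop :=
  if n is n'.+1 then gcoef e1 n' = gcoef e2 n' /\ geq_upto e1 e2 n' else True.

Lemma gdenote_eq e1 e2 : geq_upto e1 e2 (size env) -> gdenote e1 = gdenote e2.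
Proof.
move=> e12; rewrite !gdenoteE; apply: eq_bigr => i _; congr (_ ^z _).
elim: (size env) e12 i => [_ []//|n IHn] /= [en /IHn {}IHn] [i /=].
by rewrite ltnS leq_eqVlt => /orP[/eqP->//|lt_in]; apply: (IHn (Ordinal lt_in)).
Qed.

End GroupReflection.

(* Atoms are compared up to conversion: one element can be displayed through
   different coercion paths to its group. *)
Ltac gindex x l :=
  lazymatch l with
  | ?y :: ?l' =>
    match constr:(tt) with
    | _ => let _ := match constr:(tt) with _ => unify x y end in constr:(0%N)
    | _ => let n := gindex x l' in constr:(n.+1)
    end
  end.

Ltac gatoms e l :=
  lazymatch e with
  | @monoid.one _ => l
  | @monoid.mul _ ?a ?b => let l1 := gatoms a l in gatoms b l1
  | @monoid.inv _ ?a => gatoms a l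
  | expgz ?a _ => gatoms a l
  | ?a => match l with
          | _ => let n := gindex a l in l
          | _ => constr:(a :: l)
          end
  end.

Ltac greify e l :=
  lazymatch e with
  | @monoid.one _ => constr:(GOne)
  | @monoid.mul _ ?a ?b =>
      let ea := greify a l in let eb := greify b l in constr:(GMul ea eb)
  | @monoid.inv _ ?a => let ea := greify a l in constr:(GInv ea)
  | expgz ?a ?n => let ea := greify a l in constr:(GExp ea n)
  | ?a => let n := gindex a l in constr:(GAtom n)
  end.

Ltac gsemifield T :=
  match T with
  | context [?S] => lazymatch type of S with Semifield.type => S end
  end.

Ltac abelian :=
  lazymatch goal with
  | |- @eq ?T ?a ?b =>
    let S := gsemifield T in
    let l1 := gatoms a (@nil (Semifield.sort S)) in
    let l := gatoms b l1 in
    let ea := greify a l in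
    let eb := greify b l in
    apply: (@gdenote_eq S l ea eb); cbn [geq_upto size gcoef eqn];
    repeat split; rewrite /eq_op /=
  end.

Section GroupHom.
Variables (S S' : semifieldType) (f : S -> S').
Hypothesis fM : ghom f.

Lemma ghom1 : f 1 = 1.
Proof. by apply: (@mulgI _ (f 1)); rewrite -fM !mulg1. Qed.

Lemma ghomV x : f x^-1 = (f x)^-1.
Proof. by apply: (@mulIg _ (f x)); rewrite -fM !mulVg ghom1. Qed.

Lemma ghomz x n : f (x ^z n) = f x ^z n.
Proof.
have fX k : f (x ^+ k) = f x ^+ k.
  by elim: k => [|k IHk]; rewrite ?ghom1 // !expgS fM IHk.
by case: n => n /=; rewrite ?ghomV fX.
Qed.

Lemma ghom_prod (I : Type) (r : seq I) (Q : pred I) (E : I -> S) :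
  f (\prod_(i <- r | Q i) E i) = \prod_(i <- r | Q i) f (E i).
Proof.
elim: r => [|i r IHr]; rewrite ?big_nil ?ghom1 // !big_cons; case: (Q i) => //.
by rewrite fM IHr.
Qed.

End GroupHom.

Definition sfhom (S S' : semifieldType) (f : S -> S') :=
  ghom f /\ {morph f : x y / x (+) y}.

(** * Product semifields and tropical semifields *)

Section PairSemifield.
Variables P Q : semifieldType.

Definition pair_oplus (x y : P * Q) : P * Q := (x.1 (+) y.1, x.2 (+) y.2).

Lemma pair_mulgC (x y : P * Q) : x * y = y * x.
Proof. by case: x y => [a b] [c d]; congr pair; apply: mulgC. Qed.

Lemma pair_oplusA : associative pair_oplus.
Proof. by move=> x y z; rewrite /pair_oplus !oplusA. Qed.

Lemma pair_oplusC : commutative pair_oplus.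
Proof. by move=> x y; congr pair; apply: oplusC. Qed.

Lemma pair_mulg_oplusr (x y z : P * Q) :
  x * pair_oplus y z = pair_oplus (x * y) (x * z).
Proof. by congr pair; apply: mulg_oplusr. Qed.

HB.instance Definition _ := Group_isSemifield.Build (P * Q)%type
  pair_mulgC pair_oplusA pair_oplusC pair_mulg_oplusr.

End PairSemifield.

(** The integers with addition as product and minimum as sum. *)
Definition tropZ : Type := int.

HB.instance Definition _ := Choice.on tropZ.
HB.instance Definition _ := isGroup.Build tropZ
  (@addrA int) (@add0r int) (@addr0 int) (@addNr int) (@addrN int).

Lemma tropZ_mulgC (x y : tropZ) : x * y = y * x.
Proof. exact: (@addrC int). Qed.

Definition tropZ_oplus (x y : tropZ) : tropZ := Num.min (x : int) (y : int).

Lemma tropZ_mulg_oplusr (x y z : tropZ) :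
  x * tropZ_oplus y z = tropZ_oplus (x * y) (x * z).
Proof. exact: (@addr_minr int). Qed.

HB.instance Definition _ := Group_isSemifield.Build tropZ
  tropZ_mulgC (@minA _ int) (@minC _ int) tropZ_mulg_oplusr.

Lemma tropZ_expgz (a : tropZ) (z : int) : (a ^z z = (a : int) * z :> int)%R.
Proof.
have E n : ((a ^+ n)%g = (a : int) * n%:Z :> int)%R.
  elim: n => [|n IHn]; first by rewrite mulr0.
  by rewrite expgS -[LHS]/((a : int) + ((a ^+ n)%g : int))%R IHn; lia.
case: z => n; first exact: E.
by rewrite -[LHS]/(- ((a ^+ n.+1)%g : int))%R E NegzE mulrN.
Qed.

Section FfunSemifield.
Variables (I : finType) (P : semifieldType).
Implicit Types x y z : {ffun I -> P}.

Definition ffun_oplus x y := [ffun i => x i (+) y i].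

Lemma ffun_mulgC x y : x * y = y * x.
Proof. by apply/ffunP => i; rewrite !ffunE mulgC. Qed.

Lemma ffun_oplusA : associative ffun_oplus.
Proof. by move=> x y z; apply/ffunP => i; rewrite !ffunE oplusA. Qed.

Lemma ffun_oplusC : commutative ffun_oplus.
Proof. by move=> x y; apply/ffunP => i; rewrite !ffunE oplusC. Qed.

Lemma ffun_mulg_oplusr x y z :
  x * ffun_oplus y z = ffun_oplus (x * y) (x * z).
Proof. by apply/ffunP => i; rewrite !ffunE mulg_oplusr. Qed.

HB.instance Definition _ := Group_isSemifield.Build {ffun I -> P}
  ffun_mulgC ffun_oplusA ffun_oplusC ffun_mulg_oplusr.

End FfunSemifield.

Definition trop m : semifieldType := {ffun 'I_m -> tropZ}.

(** * Mutation of seeds whose cluster lies in a semifield *)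

Section PosPart.
Implicit Types a b : int.

Lemma pos_partB a : (pos_part a - pos_part (- a) = a)%R.
Proof. rewrite /pos_part; lia. Qed.

Lemma pos_part_eq0 a : (a <= 0)%R -> pos_part a = 0%R.
Proof. rewrite /pos_part; lia. Qed.

Lemma pos_partE a b :
  ((a * `|b| + `|a| * b) %/ 2)%Z = (a * pos_part b + pos_part (- a) * b)%R.
Proof.
have -> : (a * `|b| + `|a| * b)%R = ((a * pos_part b + pos_part (- a) * b) * 2)%R.
  by rewrite /pos_part; nia.
by rewrite mulzK.
Qed.

End PosPart.

(** The cluster is a family of points of a semifield [S] instead of a field, so
    that one mutation rule covers the actual cluster variables, their
    tropicalizations and their values in the coefficient semifield. *)
Record sseed (P S : Type) m := SSeed {
  sx : 'I_m -> S;
  sy : 'I_m -> P;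
  sB : 'M[int]_m
}.

Lemma sseed_eq (P S : Type) m (s t : sseed P S m) :
  sx s =1 sx t -> sy s =1 sy t -> sB s = sB t -> s = t.
Proof. by case: s t => [x y B] [x' y' B'] /= /funext-> /funext-> ->. Qed.

Section MutB.
Variables (m : nat) (k : 'I_m).
Implicit Type B : 'M[int]_m.
Local Open Scope ring_scope.

Definition mutB B : 'M[int]_m := \matrix_(i, j)
  if (i == k) || (j == k) then - B i j
  else B i j + (B i k * pos_part (B k j) + pos_part (- B i k) * B k j).

Lemma mutBK B : mutB (mutB B) = B.
Proof.
apply/matrixP => i j; rewrite !mxE !eqxx /= !orbT.
have [ik|ik] /= := eqVneq i k; first by rewrite opprK.
have [jk|jk] /= := eqVneq j k; first by rewrite opprK.
rewrite opprK; have := pos_partB (B i k); have := pos_partB (B k j).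
by move: (B i k) (B k j) => a b; rewrite /pos_part; nia.
Qed.

Lemma mutB_tr B : B^T = - B -> (mutB B)^T = - mutB B.
Proof.
move=> /matrixP BT; apply/matrixP => i j; rewrite !mxE orbC.
have E u v : B v u = - B u v by have := BT u v; rewrite !mxE.
case: ifP => _; first by rewrite (E i j).
by rewrite (E i j) (E k j) (E i k) !opprK; ring.
Qed.

Lemma mutBN B : mutB (- B) = - mutB B.
Proof.
apply/matrixP => i j; rewrite !mxE; case: ifP => // _.
have := pos_partB (B i k); have := pos_partB (B k j); rewrite opprK.
move: (pos_part _) (pos_part _) => p q.
move: (pos_part _) (pos_part _) => p' q' <- <-; ring.
Qed.

Lemma skew_diag B i : B^T = - B -> B i i = 0.
Proof. by move=> /matrixP /(_ i i); rewrite !mxE; move: (B i i) => a; lia. Qed.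

End MutB.

Section SemifieldMutation.
Variables (P S : semifieldType) (chi : P -> S) (m : nat).
Implicit Types (B : 'M[int]_m) (k : 'I_m) (x : 'I_m -> S) (y : 'I_m -> P).

Definition muty (Q : semifieldType) B k (y : 'I_m -> Q) j : Q :=
  if j == k then (y k)^-1
  else y j * y k ^z pos_part (B k j) * (y k (+) 1) ^z (- B k j)%R.

(** The coefficients enter through the group homomorphism [chi], which need not
    respect addition: [y_k (+) 1] is computed in [P], the exchange binomial
    in [S]. *)
Definition mutx B k y x j : S :=
  if j == k then
    ((chi (y k) * \prod_i x i ^z pos_part (B i k))
       (+) (\prod_i x i ^z pos_part (- B i k)%R)) / (chi (y k (+) 1) * x k)
  else x j.

Definition smut (s : sseed P S m) k : sseed P S m :=
  SSeed (mutx (sB s) k (sy s) (sx s)) (muty (sB s) k (sy s)) (mutB k (sB s)).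

(** The exchange ratio: the quotient of the two monomials of the exchange
    relation at [j]. *)
Definition yhat B y x j : S := chi (y j) * \prod_i x i ^z B i j.

Hypothesis chiM : ghom chi.

Lemma prod_pos_part B k x : \prod_i x i ^z pos_part (B i k)
  = (\prod_i x i ^z B i k) * \prod_i x i ^z pos_part (- B i k)%R.
Proof.
rewrite -big_split; apply: eq_bigr => i _ /=; rewrite -expgzD; congr (_ ^z _).
by rewrite -{2}(pos_partB (B i k)) subrK.
Qed.

(** Factoring one of its two monomials out of the exchange binomial leaves
    [yhat_k (+) 1]. *)
Lemma mutx_yhat B k y x : mutx B k y x k =
  (yhat B y x k (+) 1) * ((\prod_i x i ^z pos_part (- B i k)%R)
     / (chi (y k (+) 1) * x k)).
Proof.
rewrite /mutx eqxx prod_pos_part [RHS]mulgA; congr (_ / _).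
by rewrite mulg_oplusl mul1g /yhat mulgA.
Qed.

Lemma invg_oplus1 (Q : semifieldType) (a : Q) : a^-1 (+) 1 = (a (+) 1) / a.
Proof. by rewrite mulg_oplusl mulgV mul1g oplusC. Qed.

Lemma mutyK (Q : semifieldType) B k (y : 'I_m -> Q) :
  muty (mutB k B) k (muty B k y) =1 y.
Proof.
move=> j; rewrite /muty !eqxx; case: eqP => [->|/eqP jk]; first by rewrite invgK.
rewrite !mxE !eqxx /= invg_oplus1 opprK.
have -> : pos_part (- B k j)%R = (pos_part (B k j) - B k j)%R.
  by rewrite -{3}(pos_partB (B k j)); ring.
by abelian; ring.
Qed.

(** The exchange ratios mutate by the rule for coefficients, but in [S]: the
    exponent of the new variable in [yhat_j] is the opposite of [B k j], so its
    factor [yhat_k (+) 1] supplies the power that the rule asks for. *)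
Lemma yhat_mut B k y x : B k k = 0%R ->
  yhat (mutB k B) (muty B k y) (mutx B k y x) =1 muty B k (yhat B y x).
Proof.
move=> Bkk j; rewrite /yhat.
have prod_mutx (E : 'I_m -> int) : \prod_i mutx B k y x i ^z E i =
    mutx B k y x k ^z E k * \prod_(i | i != k) x i ^z E i.
  rewrite (bigD1 k) //=; congr (_ * _); apply: eq_bigr => i ik.
  by rewrite /mutx (negbTE ik).
rewrite prod_mutx /muty; case: eqP => [->|/eqP jk].
  rewrite mxE eqxx Bkk /= mul1g ghomV // -[LHS]/(_ * _).
  rewrite (eq_bigr (fun i => (x i ^z B i k)^-1)) => [|i ik]; last first.
    by rewrite mxE eqxx orbT expgzN.
  rewrite [in RHS](bigD1 k) //= Bkk expgz0 mul1g invgM [RHS]mulgC; congr (_ * _).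
  elim/big_rec2: _ => [|i a b _ ->]; first by rewrite invg1.
  by rewrite invgM mulgC.
rewrite mxE eqxx /=.
rewrite (eq_bigr (fun i => x i ^z B i j * ((x i ^z B i k) ^z pos_part (B k j)
   * (x i ^z pos_part (- B i k)%R) ^z B k j))) => [|i ik]; last first.
  by rewrite mxE (negbTE ik) (negbTE jk) /= -!expgzM -!expgzD addrA.
rewrite !big_split /= -!prodgz mutx_yhat /yhat.
rewrite !chiM !(ghomz chiM).
rewrite [in RHS](bigD1 (P := predT) k) //= [\prod_i x i ^z B i k](bigD1 k) //= Bkk.
rewrite [\prod_i x i ^z pos_part _](bigD1 k) //= Bkk oppr0 expgz0 mul1g.
set c := chi (y k (+) 1); set u := _ (+) 1.
by abelian; ring.
Qed.

Lemma mutxK B k y x : B k k = 0%R ->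
  mutx (mutB k B) k (muty B k y) (mutx B k y x) =1 x.
Proof.
move=> Bkk j; have [->|/eqP jk] := eqVneq j k; last first.
  by rewrite {1}/mutx (introF eqP jk) /mutx (introF eqP jk).
rewrite mutx_yhat yhat_mut // {1}/muty eqxx invg_oplus1.
rewrite [muty B k y k]/muty eqxx invg_oplus1 chiM (ghomV chiM).
rewrite (eq_bigr (fun i => x i ^z pos_part (B i k))) => [|i _]; last first.
  rewrite mxE eqxx orbT opprK /mutx; case: eqP => // ->.
  by rewrite Bkk !expgz0.
rewrite mutx_yhat prod_pos_part; set u := yhat B y x k (+) 1; rewrite /yhat.
set c := chi (y k (+) 1).
by abelian; ring.
Qed.

Lemma smutK (s : sseed P S m) k : sB s k k = 0%R -> smut (smut s k) k = s.
Proof.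
by move=> Bkk; apply: sseed_eq => /=; [apply: mutxK | apply: mutyK | apply: mutBK].
Qed.

End SemifieldMutation.

(** * Linear extension of group homomorphisms to group rings *)

Section LinearExtension.
Variables (G : semifieldType) (K : comNzRingType) (h : G -> K).
Local Open Scope ring_scope.

Definition lin (f : group_ring G) : K := monalg.mmap intr h f.

Lemma linU g c : lin (mkmalgU g c) = c%:~R * h g.
Proof. exact: mmapU. Qed.

Lemma lin_of g : lin (group_ring_of g) = h g.
Proof. by rewrite linU mul1r. Qed.

Lemma linD : {morph lin : f f' / f + f'}.
Proof. exact: mmapD. Qed.

Lemma linN : {morph lin : f / - f}.
Proof. exact: mmapN. Qed.

Lemma lin0 : lin 0 = 0.
Proof. exact: mmap0. Qed.

Lemma linB : {morph lin : f f' / f - f'}.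
Proof. by move=> f f'; rewrite linD linN. Qed.

Lemma lin_sum (I : Type) (r : seq I) (Q : pred I) E :
  lin (\sum_(i <- r | Q i) E i) = \sum_(i <- r | Q i) lin (E i).
Proof. exact: (big_morph lin linD lin0). Qed.

Hypothesis hM : forall g g', h (g * g')%g = h g * h g'.
Hypothesis h1 : h 1%g = 1.

Lemma lin1 : lin 1 = 1.
Proof. by rewrite [lin 1]lin_of. Qed.

Lemma linM : {morph lin : f f' / f * f'}.
Proof.
move=> f f'; rewrite [f * f'](_ : _ = group_ring_mul f f') // /group_ring_mul.
rewrite lin_sum [RHS]mulr_suml; apply: eq_bigr => g _.
rewrite lin_sum mulr_sumr; apply: eq_bigr => g' _.
by rewrite linU hM intrM mulrACA.
Qed.

Lemma linX f n : lin (f ^+ n) = lin f ^+ n.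
Proof. by elim: n => [|n IHn]; rewrite ?lin1 // !exprS linM IHn. Qed.

End LinearExtension.

Section GroupRingSums.
Variable G : semifieldType.
Implicit Types (g : G) (l : seq G) (f : group_ring G).
Local Open Scope ring_scope.

Lemma group_ring_ofM g g' :
  group_ring_of (g * g')%g = group_ring_of g * group_ring_of g' :> group_ring G.
Proof.
rewrite [RHS](_ : _ = group_ring_mul (group_ring_of g) (group_ring_of g')) //.
by rewrite group_ring_mulUU mul1r.
Qed.

Lemma coeff_group_ring_of g g' : monalg.mcoeff g (group_ring_of g') = (g' == g)%:R.
Proof. exact: mcoeffU. Qed.

Lemma group_ringP f f' :
  (forall g, monalg.mcoeff g f = monalg.mcoeff g f') -> f = f'.
Proof. by move/malgP. Qed.

Lemma coeff_sum (I : Type) (r : seq I) (Q : pred I) (E : I -> group_ring G) g :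
  monalg.mcoeff g (\sum_(i <- r | Q i) E i : group_ring G)
    = \sum_(i <- r | Q i) monalg.mcoeff g (E i).
Proof.
elim: r => [|i r IHr]; rewrite ?big_nil ?mcoeff0 // !big_cons; case: (Q i) => //.
by rewrite mcoeffD IHr.
Qed.

Definition gsum l : group_ring G := \sum_(g <- l) group_ring_of g.

Lemma coeff_gsum g l : monalg.mcoeff g (gsum l) = (count_mem g l)%:R.
Proof.
rewrite coeff_sum; elim: l => [|g' l IHl]; first by rewrite big_nil.
by rewrite big_cons IHl coeff_group_ring_of /= natrD.
Qed.

Lemma gsum_perm l l' : gsum l = gsum l' -> perm_eq l l'.
Proof.
move=> ll'; apply/allP => g _ /=; rewrite -(eqr_nat int).
by rewrite -!coeff_gsum ll'.
Qed.

Lemma gsum_neq0 l : l != [::] -> gsum l != 0.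
Proof.
case: l => [//|g l] _; apply: contraTneq (mem_head g l) => gl0.
rewrite -has_pred1 has_count -ltnNge ltnS -(ler_nat int) -coeff_gsum gl0.
by rewrite mcoeff0.
Qed.

(** Nonempty lists stand for the nonzero elements of the group ring that have
    nonnegative coefficients. *)
Definition lmul l l' := [seq (g * g')%g | g <- l, g' <- l'].

Lemma lmul_nnil l l' : l != [::] -> l' != [::] -> lmul l l' != [::].
Proof. by case: l l' => [|g l] [|g' l']. Qed.

Lemma gsum_lmul l l' : gsum (lmul l l') = gsum l * gsum l'.
Proof.
rewrite /gsum big_allpairs_dep /= mulr_suml; apply: eq_bigr => g _.
by rewrite mulr_sumr; apply: eq_bigr => g' _; rewrite group_ring_ofM.
Qed.

Lemma gsum_cat l l' : gsum (l ++ l') = gsum l + gsum l'.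
Proof. exact: big_cat. Qed.

End GroupRingSums.

Lemma lin_gsum (G : semifieldType) (K : comNzRingType) (h : G -> K) l :
  lin h (gsum l) = (\sum_(g <- l) h g)%R.
Proof. by rewrite lin_sum; apply: eq_bigr => g _; rewrite lin_of. Qed.

(** * Evaluation of positive sums in a semifield *)

(** Adjoining a zero turns a semifield into a commutative semiring, in which
    finite sums can be manipulated as in a ring. *)
Definition with_zero (S : semifieldType) : Type := option S.

Section WithZero.
Variable S : semifieldType.
Implicit Types a b c : with_zero S.

Definition wz_add a b : with_zero S :=
  match a, b with
  | Some x, Some y => Some (x (+) y)
  | None, _ => b
  | _, None => a
  end.

Definition wz_mul a b : with_zero S :=
  match a, b with Some x, Some y => Some (x * y) | _, _ => None end.

Lemma wz_addA : associative wz_add.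
Proof. by case=> [a|] [b|] [c|] //=; rewrite oplusA. Qed.

Lemma wz_addC : commutative wz_add.
Proof. by case=> [a|] [b|] //=; rewrite oplusC. Qed.

Lemma wz_add0 : left_id None wz_add.
Proof. by case. Qed.

Lemma wz_mulA : associative wz_mul.
Proof. by case=> [a|] [b|] [c|] //=; rewrite mulgA. Qed.

Lemma wz_mulC : commutative wz_mul.
Proof. by case=> [a|] [b|] //=; rewrite mulgC. Qed.

Lemma wz_mul1 : left_id (Some 1) wz_mul.
Proof. by case=> [a|] //=; rewrite mul1g. Qed.

Lemma wz_mulDl : left_distributive wz_mul wz_add.
Proof. by case=> [a|] [b|] [c|] //=; rewrite mulg_oplusl. Qed.

Lemma wz_mul0 : left_zero None wz_mul.
Proof. by []. Qed.

HB.instance Definition _ := Choice.on (with_zero S).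
HB.instance Definition _ :=
  Algebra.isNmodule.Build (with_zero S) wz_addA wz_addC wz_add0.
HB.instance Definition _ := GRing.Nmodule_isComPzSemiRing.Build (with_zero S)
  wz_mulA wz_mulC wz_mul1 wz_mulDl wz_mul0.

End WithZero.

Section Evaluation.
Variables (G S : semifieldType) (h : G -> S).
Implicit Types l : seq G.

Definition wz_ev l : with_zero S := (\sum_(g <- l) (Some (h g) : with_zero S))%R.

(** A sum without terms has no value in a semifield; [1] completes the
    definition on the empty list. *)
Definition ev l : S := odflt 1 (wz_ev l).

Lemma wz_evE l : l != [::] -> wz_ev l = Some (ev l).
Proof.
case: l => [//|g l] _; rewrite /ev /wz_ev big_cons.
by case: (\sum_(_ <- _) _)%R.
Qed.

Lemma ev1 g : ev [:: g] = h g.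
Proof. by rewrite /ev /wz_ev big_seq1. Qed.

Lemma ev_cat l l' : l != [::] -> l' != [::] -> ev (l ++ l') = ev l (+) ev l'.
Proof.
move=> l0 l'0; rewrite {1}/ev [wz_ev _](_ : _ = (wz_ev l + wz_ev l')%R).
  by rewrite !wz_evE.
exact: big_cat.
Qed.

Lemma ev_perm l l' : perm_eq l l' -> ev l = ev l'.
Proof. by move=> ll'; rewrite /ev /wz_ev (perm_big _ ll'). Qed.

Lemma ev_lmul l l' : ghom h -> l != [::] -> l' != [::] ->
  ev (lmul l l') = ev l * ev l'.
Proof.
move=> hM l0 l'0; rewrite {1}/ev [wz_ev _](_ : _ = (wz_ev l * wz_ev l')%R).
  by rewrite !wz_evE.
rewrite /wz_ev /lmul big_allpairs_dep /= mulr_suml; apply: eq_bigr => g _.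
by rewrite mulr_sumr; apply: eq_bigr => g' _; rewrite hM.
Qed.

End Evaluation.

Lemma ev_comp (G S S' : semifieldType) (h : G -> S) (f : S -> S') l :
  sfhom f -> l != [::] -> ev (f \o h) l = f (ev h l).
Proof.
move=> [fM fD]; elim: l => [//|g l IHl] _.
have [->|l0] := eqVneq l [::]; first by rewrite !ev1.
by rewrite -cat1s !ev_cat // fD !ev1 IHl.
Qed.

(** * The semifield of positive fractions *)

(** A copy of the group ring of [G] inside a field, given on [G]. *)
Record embedding (G : semifieldType) (K : fieldType) := Embedding {
  emb :> G -> K;
  embM : forall g g', emb (g * g') = (emb g * emb g')%R;
  emb_inj : injective (lin emb)
}.

Section PositiveFractions.
Variables (G : semifieldType) (K : fieldType) (e : embedding G K).
Implicit Types (z : K) (l : seq G).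
Local Open Scope ring_scope.

Local Notation sum l := (lin e (gsum l)).

Lemma emb_neq0 g : e g != 0.
Proof.
rewrite -lin_of -(lin0 e); apply/eqP => /emb_inj /eqP.
by rewrite monalgU_eq0.
Qed.

Lemma emb1 : e 1%g = 1.
Proof. by apply: (mulfI (emb_neq0 1%g)); rewrite -embM mulg1 mulr1. Qed.

Lemma sum_neq0 l : l != [::] -> sum l != 0.
Proof. by move/gsum_neq0; apply: contraNneq; rewrite -(lin0 e) => /emb_inj->. Qed.

Lemma sum_lmul l l' : sum (lmul l l') = sum l * sum l'.
Proof. by rewrite gsum_lmul linM ?emb1 //; apply: embM. Qed.

Lemma sum_cat l l' : sum (l ++ l') = sum l + sum l'.
Proof. by rewrite gsum_cat linD. Qed.

(** The subtraction-free elements: quotients of nonempty sums of elements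
    of [G]. *)
Definition is_posfrac z := exists l l',
  [/\ l != [::], l' != [::] & z * sum l' = sum l].

Lemma is_posfrac_neq0 z : is_posfrac z -> z != 0.
Proof.
case=> l [l' [l0 _ zl]]; apply: contraTneq (sum_neq0 l0) => z0.
by rewrite -zl z0 mul0r eqxx.
Qed.

Lemma is_posfrac_emb g : is_posfrac (e g).
Proof.
by exists [:: g], [:: 1%g]; rewrite !lin_gsum !big_seq1 emb1 mulr1.
Qed.

Lemma is_posfracM z z' : is_posfrac z -> is_posfrac z' -> is_posfrac (z * z').
Proof.
move=> [l1 [l2 [l1n l2n zl]]] [l3 [l4 [l3n l4n zl']]].
exists (lmul l1 l3), (lmul l2 l4); rewrite !lmul_nnil // !sum_lmul -zl -zl'.
by rewrite mulrACA.
Qed.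

Lemma is_posfracD z z' : is_posfrac z -> is_posfrac z' -> is_posfrac (z + z').
Proof.
move=> [l1 [l2 [l1n l2n zl]]] [l3 [l4 [l3n l4n zl']]].
exists (lmul l1 l4 ++ lmul l3 l2), (lmul l2 l4).
rewrite !lmul_nnil // sum_cat !sum_lmul -zl -zl'; split=> //.
  by case: (lmul l1 l4) (lmul_nnil l1n l4n).
by ring.
Qed.

Lemma is_posfracV z : is_posfrac z -> is_posfrac z^-1.
Proof.
move=> zP; have z0 := is_posfrac_neq0 zP.
have [l [l' [l0 l'0 zl]]] := zP; exists l', l; split=> //.
by rewrite -zl mulKf.
Qed.

Definition posfrac := {z | `[< is_posfrac z >]}.

HB.instance Definition _ := Choice.on posfrac.

Definition pf_val (a : posfrac) : K := val a.

Definition Posfrac z (zP : is_posfrac z) : posfrac := exist _ z (asboolT zP).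

Lemma pf_valP a : is_posfrac (pf_val a).
Proof. exact/asboolP/(valP a). Qed.

Lemma pf_val_inj : injective pf_val.
Proof. exact: val_inj. Qed.

Lemma pf_val_neq0 a : pf_val a != 0.
Proof. exact/is_posfrac_neq0/pf_valP. Qed.

Definition pf_emb g : posfrac := Posfrac (is_posfrac_emb g).
Definition pf_mul a b : posfrac := Posfrac (is_posfracM (pf_valP a) (pf_valP b)).
Definition pf_inv a : posfrac := Posfrac (is_posfracV (pf_valP a)).
Definition pf_add a b : posfrac := Posfrac (is_posfracD (pf_valP a) (pf_valP b)).

Lemma pf_mulA : associative pf_mul.
Proof. by move=> a b c; apply: pf_val_inj; apply: mulrA. Qed.

Lemma pf_mulC a b : pf_mul a b = pf_mul b a.
Proof. by apply: pf_val_inj; apply: mulrC. Qed.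

Lemma pf_mul1 : left_id (pf_emb 1%g) pf_mul.
Proof. by move=> a; apply: pf_val_inj; rewrite -[LHS]/(e 1%g * pf_val a) emb1 mul1r. Qed.

Lemma pf_mulr1 : right_id (pf_emb 1%g) pf_mul.
Proof. by move=> a; rewrite pf_mulC pf_mul1. Qed.

Lemma pf_mulV : left_inverse (pf_emb 1%g) pf_inv pf_mul.
Proof.
move=> a; apply: pf_val_inj.
rewrite -[LHS]/((pf_val a)^-1 * pf_val a) -[RHS]/(e 1%g) emb1 mulVf //.
exact: pf_val_neq0.
Qed.

Lemma pf_mulrV : right_inverse (pf_emb 1%g) pf_inv pf_mul.
Proof. by move=> a; rewrite pf_mulC pf_mulV. Qed.

Lemma pf_addA : associative pf_add.
Proof. by move=> a b c; apply: pf_val_inj; apply: addrA. Qed.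

Lemma pf_addC : commutative pf_add.
Proof. by move=> a b; apply: pf_val_inj; apply: addrC. Qed.

Lemma pf_mulDr a b c : pf_mul a (pf_add b c) = pf_add (pf_mul a b) (pf_mul a c).
Proof. by apply: pf_val_inj; apply: mulrDr. Qed.

HB.instance Definition _ := isGroup.Build posfrac
  pf_mulA pf_mul1 pf_mulr1 pf_mulV pf_mulrV.
HB.instance Definition _ := Group_isSemifield.Build posfrac
  pf_mulC pf_addA pf_addC pf_mulDr.

Lemma pf_embM : ghom pf_emb.
Proof. by move=> g g'; apply: pf_val_inj; apply: embM. Qed.

Lemma pf_valM a b : pf_val (a * b)%g = pf_val a * pf_val b.
Proof. by []. Qed.

Lemma pf_valD a b : pf_val (a (+) b)%g = pf_val a + pf_val b.
Proof. by []. Qed.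

Lemma pf_val1 : pf_val 1%g = 1.
Proof. exact: emb1. Qed.

Lemma pf_valV a : pf_val a^-1%g = (pf_val a)^-1.
Proof. by []. Qed.

Lemma pf_val_emb g : pf_val (pf_emb g) = e g.
Proof. by []. Qed.

(** The semifield of positive fractions is free on the group [G]: any group
    homomorphism to a semifield extends to it. Two positive sums that agree in
    the field have the same terms, so they take the same value in every
    semifield; this fails for sums with signs. *)
Section Extension.
Variables (S : semifieldType) (phi : G -> S).
Hypothesis phiM : ghom phi.

Lemma pf_ext_subproof (a : posfrac) : exists l, exists l',
  [/\ l != [::], l' != [::] & pf_val a * sum l' = sum l].
Proof. exact: pf_valP. Qed.

Definition pf_ext (a : posfrac) : S :=
  let: exist l lP := cid (pf_ext_subproof a) in
  let: exist l' _ := cid lP in (ev phi l / ev phi l')%g.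

Lemma pf_extE a l l' : l != [::] -> l' != [::] ->
  pf_val a * sum l' = sum l -> pf_ext a = (ev phi l / ev phi l')%g.
Proof.
move=> l0 l'0 al; rewrite /pf_ext; case: cid => l1 l1P.
case: cid => l2 [l10 l20 al12].
apply: (@mulIg _ (ev phi l2 * ev phi l')%g); rewrite mulgA mulgVK.
rewrite (mulgC (ev phi l2)) mulgA mulgVK -!ev_lmul //; apply: ev_perm.
apply/gsum_perm/(@emb_inj _ _ e); rewrite !sum_lmul -al12 -al.
by rewrite mulrAC.
Qed.

Lemma pf_ext_hom : sfhom pf_ext.
Proof.
split=> a b; have [l1 [l2 [l10 l20 al]]] := pf_valP a;
  have [l3 [l4 [l30 l40 bl]]] := pf_valP b;
  rewrite (pf_extE l10 l20 al) (pf_extE l30 l40 bl).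
  rewrite (@pf_extE _ (lmul l1 l3) (lmul l2 l4)) ?lmul_nnil //.
    by rewrite !ev_lmul //; abelian; ring.
  by rewrite !sum_lmul pf_valM -al -bl mulrACA.
rewrite (@pf_extE _ (lmul l1 l4 ++ lmul l3 l2) (lmul l2 l4)) ?lmul_nnil //.
- rewrite ev_cat ?lmul_nnil // !ev_lmul // mulg_oplusl.
  by congr (_ (+) _)%g; abelian; ring.
- by case: (lmul l1 l4) (lmul_nnil l10 l40).
- by rewrite sum_cat !sum_lmul pf_valD -al -bl; ring.
Qed.

Lemma pf_ext_emb g : pf_ext (pf_emb g) = phi g.
Proof.
rewrite (@pf_extE _ [:: g] [:: 1%g]) //; first by rewrite !ev1 ghom1 // divg1.
by rewrite pf_val_emb !lin_gsum !big_seq1 emb1 mulr1.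
Qed.

End Extension.

End PositiveFractions.

(** * Arithmetic of group rings *)

Section Restriction.
Variable G : semifieldType.
Implicit Types (g : G) (f a : group_ring G) (A : pred G).
Local Open Scope ring_scope.

Local Notation coeff := (@monalg.mcoeff G int).
Local Notation supp := (@monalg.msupp G int).

Lemma group_ringE f :
  f = \sum_(g <- supp f) mkmalgU g (coeff g f) :> group_ring G.
Proof. exact: monalgE. Qed.

(** The terms of [f] that lie in [A]. Restriction commutes with multiplication
    by [a] when [A] is stable under translation by the support of [a], and so
    replaces gradings and coset decompositions. *)
Definition restr A f : group_ring G :=
  \sum_(g <- supp f) (if A g then mkmalgU g (coeff g f) else 0).

Lemma coeff_restr A f g : coeff g (restr A f) = if A g then coeff g f else 0.
Proof.
rewrite /restr coeff_sum [f in RHS]group_ringE coeff_sum.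
rewrite (eq_bigr (fun g' => if A g then coeff g (mkmalgU g' (coeff g' f)) else 0)).
  case: ifP => _; first by [].
  by rewrite big1.
move=> g' _; case: (eqVneq g' g) => [->|g'g].
  by case: ifP => _; rewrite ?mcoeff0.
rewrite [coeff g (mkmalgU _ _)]mcoeffU (negbTE g'g) mulr0n if_same.
by case: ifP => _; rewrite ?mcoeff0 // mcoeffU (negbTE g'g) mulr0n.
Qed.

Lemma restrD A f f' : restr A (f + f') = restr A f + restr A f'.
Proof.
by apply/group_ringP => g; rewrite mcoeffD !coeff_restr mcoeffD; case: ifP => //=;
  rewrite addr0.
Qed.

Lemma restr0 A : restr A 0 = 0.
Proof. by apply/group_ringP => g; rewrite coeff_restr mcoeff0 if_same. Qed.

Lemma restrN A f : restr A (- f) = - restr A f.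
Proof.
by apply/group_ringP => g; rewrite mcoeffN !coeff_restr mcoeffN; case: ifP => //=;
  rewrite oppr0.
Qed.

Lemma restr_sum A (I : Type) (r : seq I) (Q : pred I) E :
  restr A (\sum_(i <- r | Q i) E i) = \sum_(i <- r | Q i) restr A (E i).
Proof. exact: (big_morph (restr A) (restrD A) (restr0 A)). Qed.

Lemma restr_id A f : {in supp f, forall g, A g} -> restr A f = f.
Proof.
move=> fA; apply/group_ringP => g; rewrite coeff_restr; case: ifPn => // gA.
by rewrite mcoeff_outdom //; apply: contra gA => /fA.
Qed.

Lemma restr_eq0 A f : {in supp f, forall g, ~~ A g} -> restr A f = 0.
Proof.
move=> fA; apply/group_ringP => g; rewrite coeff_restr mcoeff0; case: ifP => // gA.
by rewrite mcoeff_outdom //; apply: contraL gA => /fA.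
Qed.

Lemma coeffMU f g g' c : coeff g (f * mkmalgU g' c) = coeff (g / g')%g f * c.
Proof.
rewrite {1}[f]group_ringE mulr_suml coeff_sum.
rewrite [f in RHS]group_ringE coeff_sum mulr_suml; apply: eq_bigr => x _.
rewrite [_ * (mkmalgU g' c : group_ring G)](_ : _ = mkmalgU (x * g')%g (coeff x f * c)); last first.
  exact: group_ring_mulUU.
rewrite !mcoeffU mulrnAl; congr (_ *+ nat_of_bool _).
by apply/eqP/eqP => [<-|->]; rewrite ?mulgK ?mulgVK.
Qed.

Lemma restrM A A' f a :
  (forall g g', g' \in supp a -> A (g * g')%g = A' g) ->
  restr A (f * a) = restr A' f * a.
Proof.
move=> AA'; rewrite [in LHS](group_ringE a) [in RHS](group_ringE a).
rewrite !mulr_sumr restr_sum big_seq [RHS]big_seq; apply: eq_bigr => g' g'a.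
apply/group_ringP => g; rewrite coeff_restr !coeffMU coeff_restr.
by rewrite -{1}(mulgVK g' g) (AA' _ _ g'a); case: ifP => // _; rewrite mul0r.
Qed.

Lemma restrMX A f a n :
  (forall g g', g' \in supp a -> A (g * g')%g = A g) ->
  restr A (f * a ^+ n) = restr A f * a ^+ n.
Proof.
move=> Aa; elim: n => [|n IHn]; first by rewrite !mulr1.
by rewrite exprSr !mulrA (restrM _ Aa) IHn.
Qed.

Lemma suppM f a g : g \in supp (f * a) ->
  exists2 x, x \in supp f & exists2 y, y \in supp a & g = (x * y)%g.
Proof.
move=> gfa; apply: contrapT => noxy; move: gfa; rewrite -mcoeff_neq0 => /eqP[].
rewrite group_ring_coeffM big_seq big1 // => x xf; rewrite big_seq_cond big1 //.
by move=> y /andP[ya /eqP xy]; case: noxy; exists x => //; exists y.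
Qed.

Lemma supp_neq0 f : f != 0 -> exists g, g \in supp f.
Proof.
move=> f0; apply/fset0Pn; apply: contraNneq f0 => suppf.
by rewrite [f]group_ringE suppf big_seq_fset0.
Qed.

Lemma coeff_one g : coeff g (1 : group_ring G) = (1%g == g)%:R.
Proof. exact: coeff_group_ring_of. Qed.

Lemma supp1of g : {in supp (1 + group_ring_of g), forall x, x = 1%g \/ x = g}.
Proof.
move=> x; have [->|x1] := eqVneq x 1%g; first by left.
have [->|xg] := eqVneq x g; first by right.
rewrite -mcoeff_neq0 mcoeffD coeff_one coeff_group_ring_of.
by rewrite ![_ == x]eq_sym (negbTE x1) (negbTE xg).
Qed.

Lemma one_add_of_neq0 g : 1 + group_ring_of g != 0.
Proof.
apply/eqP => /(congr1 (coeff 1%g)); rewrite mcoeffD mcoeff0.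
rewrite coeff_one coeff_group_ring_of eqxx.
by case: eqP.
Qed.

End Restriction.

Section GroupRingArithmetic.
Variable G : semifieldType.
Implicit Types (g h : G) (f a u v w : group_ring G) (A : pred G).
Local Open Scope ring_scope.

Local Notation coeff := (@monalg.mcoeff G int).
Local Notation supp := (@monalg.msupp G int).

Lemma eventually_all (T : eqType) (s : seq T) (Q : T -> nat -> Prop) :
  {in s, forall x, exists N, forall n, (N <= n)%N -> Q x n} ->
  exists N, {in s, forall x, Q x N}.
Proof.
move=> sQ; suff [N NP] : exists N, forall n, (N <= n)%N -> {in s, forall x, Q x n}.
  by exists N; apply: NP.
elim: s sQ => [|x s IHs] sQ; first by exists 0%N.
have [N1 N1P] := sQ x (mem_head x s).
have [|N2 N2P] := IHs; first by move=> z zs; apply: sQ; rewrite in_cons zs orbT.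
exists (maxn N1 N2) => n; rewrite geq_max => /andP[n1 n2] z.
by rewrite in_cons => /orP[/eqP->|zs]; [apply: N1P | apply: N2P].
Qed.

(** Modulo [1 + h], multiplication by [g ^+ n] changes [u] at most by a sign,
    yet for large [n] it moves the support of [u] to cosets of the powers of
    [h] that do not meet it; restricting to the cosets that meet the support
    leaves [u] as a multiple of [1 + h]. *)
Lemma coprime_1of g h u v :
  (forall n p : int, (g ^z n * h ^z p)%g = 1%g -> n = 0) ->
  (1 + group_ring_of g) * u = (1 + group_ring_of h) * v ->
  exists w, u = (1 + group_ring_of h) * w.
Proof.
move=> gh guv; pose H := 1 + group_ring_of h.
have gnu n : exists w, u * group_ring_of (g ^+ n)%g = (-1) ^+ n * u + H * w.
  elim: n => [|n [w wP]].
    by exists 0; rewrite expg0 mulr0 addr0 mul1r; apply: mulr1.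
  exists ((-1) ^+ n * v + group_ring_of g * w).
  have gu : group_ring_of g * u = - u + H * v by rewrite -guv; ring.
  rewrite expgSr group_ring_ofM mulrA wP exprS.
  transitivity ((-1) ^+ n * (group_ring_of g * u) + H * (group_ring_of g * w)).
    by ring.
  by rewrite gu; ring.
pose A x := `[< exists2 s, s \in supp u & exists p : int, x = (s * h ^z p)%g >].
have Ah x : A (x * h)%g = A x.
  apply/asboolP/asboolP => -[s su [p xp]]; exists s => //.
    by exists (p - 1); rewrite expgzD expgzN expgz1 mulgA -xp mulgK.
  by exists (p + 1); rewrite expgzS mulgA xp.
have [N NP] : exists N, {in supp u, forall s, ~~ A (s * g ^+ N)%g}.
  apply: eventually_all => s su.
  have [|N NP] := @eventually_all _ (supp u)
      (fun s' n => forall k, (n <= k)%N -> forall p, (s * g ^+ k)%g <> (s' * h ^z p)%g).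
    move=> s' s'u.
    have [[k0 [p0 k0P]]|no] := pselect (exists k p, (s * g ^+ k)%g = (s' * h ^z p)%g).
      exists k0.+1 => n k0n k nk p kp.
      have kE : (g ^+ k * h ^z (p0 - p) = g ^+ k0)%g.
        apply: (@mulgI _ s); rewrite mulgA kp k0P expgzD expgzN.
        by abelian; ring.
      have : (g ^z (Posz k - Posz k0) * h ^z (p0 - p) = 1)%g.
        apply: (@mulgI _ (g ^z k0)); rewrite mulgA -expgzD addrC subrK.
        by rewrite mulg1 -[RHS]kE.
      by move/gh; lia.
    by exists 0%N => n _ k _ p kp; apply: no; exists k, p.
  exists N => n Nn; apply/asboolPn => -[s' s'u [p]]; exact: NP.
have [w wP] := gnu N.
have HA x y : y \in supp H -> A (x * y)%g = A x.
  by case/supp1of => ->; rewrite ?mulg1.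
have := congr1 (restr A) wP.
rewrite (restrM (A' := fun x => A (x * g ^+ N)%g)); last first.
  move=> x y; have [->//|gy] := eqVneq (g ^+ N)%g y.
  by rewrite -mcoeff_neq0 coeff_group_ring_of (negbTE gy).
rewrite restr_eq0 // mul0r restrD [H * w]mulrC (restrM _ HA).
rewrite (_ : restr A ((-1) ^+ N * u) = (-1) ^+ N * u); last first.
  have Au : restr A u = u.
    apply: restr_id => s su; apply/asboolP; exists s => //.
    by exists 0; rewrite expgz0 mulg1.
  have [->|->] : ((-1) ^+ N = 1 :> group_ring G) \/ ((-1) ^+ N = -1 :> group_ring G).
    by rewrite -signr_odd; case: (odd N); [right | left].
    by rewrite !mul1r.
  by rewrite !mulN1r restrN Au.
move=> /(congr1 ( *%R ((-1) ^+ N))); rewrite mulr0 mulrDr mulrA -exprD addnn.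
rewrite -mul2n exprM sqrrN !expr1n mul1r => /esym/eqP; rewrite addr_eq0 => /eqP->.
by exists (- ((-1) ^+ N * restr A w)); rewrite -/H; ring.
Qed.

Section Grading.
Variable d : G -> int.
Hypothesis dM : forall g h, d (g * h)%g = d g + d h.

Lemma exists_min_degree f : f != 0 ->
  exists2 g, g \in supp f & {in supp f, forall g', d g <= d g'}.
Proof.
move=> /supp_neq0[g0 g0f].
have min_seq (s : seq G) x : x \in s ->
    exists2 g, g \in s & {in s, forall g', d g <= d g'}; last exact: min_seq g0f.
elim: s x => [//|g s IHs] x _.
case: s IHs => [|g1 s] IHs.
  by exists g; rewrite ?mem_head // => g'; rewrite mem_seq1 => /eqP->.
have [g2 g2s g2P] := IHs g1 (mem_head _ _).
have [dg|dg] := leP (d g) (d g2); [exists g | exists g2].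
- exact: mem_head.
- move=> g'; rewrite in_cons => /orP[/eqP->//|/g2P]; exact: le_trans.
- by rewrite in_cons g2s orbT.
- move=> g'; rewrite in_cons => /orP[/eqP->|/g2P //]; exact: ltW.
Qed.

(** Lowest homogeneous parts multiply to the lowest part of the product,
    because a group ring is a domain. *)
Lemma min_degree_quotient f a r (q0 r0 : int) : f * a = r ->
  (exists2 g, g \in supp a & d g = q0) -> {in supp a, forall g, q0 <= d g} ->
  {in supp r, forall g, r0 <= d g} -> {in supp f, forall g, r0 - q0 <= d g}.
Proof.
move=> far [ga gaa dga] aq rr g gf.
have f0 : f != 0.
  by apply: contraTneq gf => ->; rewrite msupp0.
have [g1 g1f g1P] := exists_min_degree f0.
apply: le_trans (g1P _ gf); rewrite lerBlDr.
pose D n : pred G := fun g => d g == n.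
pose f1 := restr (D (d g1)) f; pose a1 := restr (D q0) a.
have nz n b x : x \in supp b -> d x = n -> restr (D n) b != 0.
  move=> xb dx; apply/eqP => /(congr1 (coeff x)); rewrite coeff_restr mcoeff0.
  by rewrite /D dx eqxx; apply/eqP; rewrite mcoeff_neq0.
have /supp_neq0[x xfa] : f1 * a1 != 0.
  by apply: mulf_neq0; [apply: nz g1f _ | apply: nz gaa dga].
have supp_restr A b y : y \in supp (restr A b) -> A y /\ y \in supp b.
  by rewrite -!mcoeff_neq0 coeff_restr; case: ifP => //; rewrite eqxx.
have f1a1 : f1 * a1 = restr (D (d g1 + q0)) r.
  have -> : r = f * a1 + f * (a - a1) by rewrite -mulrDr addrC subrK.
  rewrite restrD [X in _ = _ + X]restr_eq0 ?addr0; last first.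
    move=> y /suppM[y1 y1f [y2]]; rewrite -mcoeff_neq0 mcoeffB coeff_restr.
    case: ifPn => [_|y2q]; first by rewrite subrr eqxx.
    rewrite subr0 mcoeff_neq0 => y2a ->; rewrite /D dM; apply/negP => /eqP.
    have := g1P _ y1f; have := aq _ y2a; move: y2q; rewrite /D; lia.
  rewrite (restrM (A' := D (d g1))) // => y y' /supp_restr[/eqP y'q _].
  by rewrite /D dM y'q; apply/eqP/eqP; lia.
have [/eqP <- xr] : D (d g1 + q0) x /\ x \in supp r.
  by apply: supp_restr; rewrite -f1a1.
exact: rr.
Qed.

(** Substituting [theta g * a ^+ (N + d g)] for each monomial [g] loses nothing:
    the degree [d] of [theta g] tells the exponent of [a] back. *)
Lemma graded_substitution (theta : G -> G) a f (N : int) :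
  injective theta -> (forall g, d (theta g) = - d g) ->
  {in supp a, forall g, d g = 0} -> a != 0 ->
  \sum_(g <- supp f) (mkmalgU (theta g) (coeff g f) : group_ring G) * a ^+ absz (N + d g) = 0 ->
  f = 0.
Proof.
move=> theta_inj dtheta da a0 sum0; apply/eqP; apply/negPn/negP => f0.
have [g0 g0f] := supp_neq0 f0.
pose E g : group_ring G := mkmalgU (theta g) (coeff g f).
pose A : pred G := fun g => d g == - d g0.
have := congr1 (restr A) sum0; rewrite restr0 restr_sum.
pose b := \sum_(g <- supp f | d g == d g0) E g.
have restrU g : restr A (E g)
    = if d g == d g0 then E g else 0.
  case: ifPn => dg; [apply: restr_id | apply: restr_eq0] => x /(fsubsetP msuppU_le);
    by rewrite in_fset1 => /eqP->; rewrite /A dtheta eqr_opp.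
rewrite (eq_bigr (fun g => (if d g == d g0 then E g else 0)
    * a ^+ absz (N + d g0))) => [|g _]; last first.
  rewrite restrMX ?restrU => [|x y /da dy]; last by rewrite /A dM dy addr0.
  by case: eqP => [->//|_]; rewrite !mul0r.
rewrite -mulr_suml -big_mkcond -/b => /eqP; rewrite mulf_eq0 expf_eq0 (negbTE a0).
rewrite andbF orbF => /eqP/(congr1 (coeff (theta g0))).
rewrite mcoeff0 /b coeff_sum big_mkcond (bigD1_seq g0) ?fset_uniq //= eqxx.
rewrite mcoeffUU big1 ?addr0 => [/eqP|g gg0]; first by rewrite mcoeff_eq0 g0f.
by rewrite mcoeffU (inj_eq theta_inj) (negbTE gg0) if_same.
Qed.

End Grading.

End GroupRingArithmetic.

(** * Units of group rings *)

Section Units.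
Variable G : semifieldType.
Implicit Types (f : group_ring G) (a b x y : G) (C : G -> Prop).
Local Open Scope fset_scope.

Local Notation coeff := (@monalg.mcoeff G int).
Local Notation supp := (@monalg.msupp G int).

Lemma coeff_unique_product f f' a b : a \in supp f -> b \in supp f' ->
  (forall x y, x \in supp f -> y \in supp f' -> x * y = a * b -> x = a /\ y = b) ->
  coeff (a * b) (f * f')%R = (coeff a f * coeff b f')%R.
Proof.
move=> fa fb ab; rewrite group_ring_coeffM (bigD1_seq a) ?fset_uniq //=.
rewrite [X in (_ + X)%R]big1_seq ?addr0 => [|x /andP[/eqP xa fx]]; last first.
  rewrite big_seq_cond big1 // => y /andP[fy /eqP xy].
  by have [] := ab x y fx fy xy.
rewrite big_mkcond (bigD1_seq b) ?fset_uniq //= eqxx big1_seq ?addr0 //.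
move=> y /andP[/eqP yb fy]; case: eqP => // ay.
by have [] := ab a y fa fy ay.
Qed.

Lemma exists_max C (s : seq G) x : (forall a b, C a -> C b -> C (a * b)) ->
  (forall a b, a \in s -> b \in s -> a <> b -> C (a / b) \/ C (b / a)) ->
  x \in s -> exists2 a, a \in s & {in s, forall b, b <> a -> C (a / b)}.
Proof.
move=> CM; elim: s x => [//|a s IHs] x tot _.
case: s IHs tot => [|b s] IHs tot.
  by exists a; rewrite ?mem_head // => c; rewrite mem_seq1 => /eqP->.
have [|c cs cP] := IHs b _ (mem_head b s).
  by move=> c d cs ds; apply: tot; rewrite in_cons ?cs ?ds orbT.
have [ac|/eqP ac] := eqVneq a c.
  exists c; first by rewrite in_cons cs orbT.
  by move=> d; rewrite in_cons => /orP[/eqP->|/cP //]; rewrite ac.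
have [||Cac|Cca] := tot a c _ _ ac; rewrite ?mem_head //; first by rewrite in_cons cs orbT.
- exists a; first exact: mem_head.
  move=> d; rewrite in_cons => /orP[/eqP-> //|ds _].
  have [->//|/eqP dc] := eqVneq d c.
  by rewrite -(mulgVK c a) -mulgA; apply: CM => //; apply: cP.
- exists c; first by rewrite in_cons cs orbT.
  by move=> d; rewrite in_cons => /orP[/eqP->//|/cP].
Qed.

(** The group is orderable on the finitely many elements in play. The greatest
    terms of the two factors, and likewise the least terms, multiply to a term
    that nothing cancels; the product has only one term, so greatest and least
    coincide. *)
Lemma group_ring_unit_monomial f f' : (f * f' = 1)%R ->
  exists2 g, supp f = [fset g] & (coeff g f * coeff (g^-1)%g f' = 1)%R.
Proof.
move=> ff'1.
have f0 : f != 0%R.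
  by apply: contra_eq_neq ff'1 => ->; rewrite mul0r eq_sym oner_eq0.
have f'0 : f' != 0%R.
  by apply: contra_eq_neq ff'1 => ->; rewrite mulr0 eq_sym oner_eq0.
have [x0 x0f] := supp_neq0 f0; have [y0 y0f] := supp_neq0 f'0.
pose s := (enum_fset (supp f) ++ enum_fset (supp f') : seq G).
have [C [[C1 CM] Cs]] := exists_cone [seq a / b | a <- s, b <- s].
have tot a b : a \in s -> b \in s -> a <> b -> C (a / b) \/ C (b / a).
  move=> sa sb ab; rewrite -[b / a]invgF; apply: Cs; first exact: allpairs_f.
  by move=> ab1; apply: ab; rewrite -(mulgVK b a) ab1 mul1g.
have totf a b : a \in supp f -> b \in supp f -> a <> b -> C (a / b) \/ C (b / a).
  by move=> fa fb; apply: tot; rewrite mem_cat ?fa ?fb.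
have totf' a b : a \in supp f' -> b \in supp f' -> a <> b -> C (a / b) \/ C (b / a).
  by move=> fa fb; apply: tot; rewrite mem_cat ?fa ?fb orbT.
have prod1 (D : G -> Prop) a b : (forall c d, D c -> D d -> D (c * d)) -> ~ D 1 ->
    a \in supp f -> {in supp f, forall x, x <> a -> D (a / x)} ->
    b \in supp f' -> {in supp f', forall y, y <> b -> D (b / y)} ->
    a * b = 1 /\ (coeff a f * coeff b f' = 1)%R.
  move=> DM D1 fa aP fb bP; have := @coeff_unique_product f f' a b fa fb.
  rewrite ff'1 coeff_one => abE.
  have {}abE : ((1%g == (a * b)%g)%:R = coeff a f * coeff b f')%R.
    apply: abE => x y fx fy xyab.
    have axyb : a / x = y / b.
      have -> : y = x^-1 * (a * b) by rewrite -xyab mulKg.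
      by rewrite mulgA mulgK mulgC.
    have [xa|/eqP xa] := eqVneq x a.
      by split=> //; move: xyab; rewrite xa => /mulgI.
    have [yb|/eqP yb] := eqVneq y b.
      by split=> //; move: xyab; rewrite yb => /mulIg.
    case: D1; rewrite -(mulgV (a / x)); apply: DM; first exact: aP.
    by rewrite axyb invgF; apply: bP.
  move: (fa) (fb); rewrite -!mcoeff_neq0 => fa0 fb0.
  move: abE; case: eqP => [<- /esym //|_ /esym/eqP].
  by rewrite mulf_eq0 (negbTE fa0) (negbTE fb0).
have [a fa aP] := exists_max CM totf x0f.
have [b fb bP] := exists_max CM totf' y0f.
have [||a' fa' a'P] := @exists_max (fun x => C x^-1) _ x0 _ _ x0f.
- by move=> c d Cc Cd; rewrite invgM; apply: CM.
- by move=> c d fc fd cd; rewrite !invgF; have [] := totf c d fc fd cd; auto.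
have [||b' fb' b'P] := @exists_max (fun x => C x^-1) _ y0 _ _ y0f.
- by move=> c d Cc Cd; rewrite invgM; apply: CM.
- by move=> c d fc fd cd; rewrite !invgF; have [] := totf' c d fc fd cd; auto.
have [ab1 cab] := prod1 C a b CM C1 fa aP fb bP.
have [||a'b'1 _] := prod1 (fun x => C x^-1) a' b' _ _ fa' a'P fb' b'P.
- by move=> c d Cc Cd; rewrite invgM; apply: CM.
- by rewrite invg1.
have bE : b = a^-1 by apply/esym/mulg1_eq.
have b'E : b' = a'^-1 by apply/esym/mulg1_eq.
have aa' : a = a'.
  have [//|/eqP aa'] := eqVneq a a'.
  have bb' : b' <> b by rewrite bE b'E => /invg_inj/esym.
  case: C1; rewrite -(mulgV (a / a')); apply: CM; first by apply: aP => // /esym.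
  have := bP b' fb' bb'; rewrite bE b'E invgK.
  by rewrite mulgC invgF.
exists a; last by rewrite -bE.
apply/fsetP => x; rewrite in_fset1; apply/idP/eqP => [fx|->//].
have [//|/eqP xa] := eqVneq x a.
case: C1; rewrite -(mulgV (a / x)); apply: CM; first exact: aP.
by rewrite aa'; apply: a'P => //; rewrite -aa'.
Qed.

End Units.

(** * Walks in the mutation graph *)

Section Walks.
Variables (P S : semifieldType) (chi : P -> S) (m : nat).
Implicit Types (s : sseed P S m) (ks : seq 'I_m).

Definition walk s ks := foldl (fun t k => smut chi t k) s ks.

Lemma walk_cat s ks ks' : walk s (ks ++ ks') = walk (walk s ks) ks'.
Proof. exact: foldl_cat. Qed.

Lemma walk_skew s ks : (sB s)^T%R = (- sB s)%R ->
  (sB (walk s ks))^T%R = (- sB (walk s ks))%R.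
Proof. by elim: ks s => [//|k ks IHks] s sT; apply: IHks; apply: mutB_tr. Qed.

(** Mutation is an involution, so any seed of the pattern can be taken as the
    initial one. *)
Lemma walkK s ks : ghom chi -> (sB s)^T%R = (- sB s)%R ->
  walk (walk s ks) (rev ks) = s.
Proof.
move=> chiM; elim: ks s => [//|k ks IHks] s sT.
rewrite rev_cons -cats1 walk_cat IHks; last exact: mutB_tr.
by rewrite /= smutK // skew_diag.
Qed.

End Walks.

Section Naturality.
Variables (P S P' S' : semifieldType) (chi : P -> S) (chi' : P' -> S') (m : nat).
Variables (pi : P -> P') (f : S -> S').
Hypotheses (pi_hom : sfhom pi) (f_hom : sfhom f).
Hypothesis chi_nat : forall p, chi' (pi p) = f (chi p).

(** Mutation is natural in both semifields; comparisons between different cluster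
    algebras below are instances of this. *)
Definition smap (s : sseed P S m) : sseed P' S' m :=
  SSeed (f \o sx s) (pi \o sy s) (sB s).

Lemma smut_map s k : smut chi' (smap s) k = smap (smut chi s k).
Proof.
have [piM piD] := pi_hom; have [fM fD] := f_hom.
have pi_add1 p : pi p (+) 1 = pi (p (+) 1) by rewrite piD (ghom1 piM).
apply: sseed_eq => //= j; last first.
  rewrite /muty /=; case: eqP => _; first by rewrite (ghomV piM).
  by rewrite !piM !(ghomz piM) piD (ghom1 piM).
rewrite /mutx /=; case: eqP => // _.
rewrite fM (ghomV fM) fM fD fM !(ghom_prod fM) pi_add1 !chi_nat.
by congr ((_ * _ (+) _) / _); apply: eq_bigr => i _; rewrite (ghomz fM).
Qed.

Lemma walk_map s ks : walk chi' (smap s) ks = smap (walk chi s ks).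
Proof. by elim: ks s => [//|k ks IHks] s; rewrite /= smut_map IHks. Qed.

End Naturality.

(** * Laurent polynomials in a cluster *)

(** [v] stands for the inclusion of a semifield [S] of positive elements in a
    field [K]. *)
Section LaurentRing.
Variables (P S : semifieldType) (chi : P -> S) (K : fieldType) (v : S -> K) (m : nat).
Hypothesis chiM : ghom chi.
Hypothesis vM : forall a b, v (a * b) = (v a * v b)%R.
Hypothesis vD : forall a b, v (a (+) b) = (v a + v b)%R.
Hypothesis v1 : v 1 = 1%R.

Implicit Types (x : 'I_m -> S) (s : sseed P S m) (j k : 'I_m).

(** Laurent monomials with coefficients in [P] form the semifield [P * Z^m], so
    the Laurent polynomial ring over the group ring of [P] is itself the group
    ring of a semifield, hence a domain. *)
Definition monom : semifieldType := (P * trop m)%type.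

Implicit Types (g h : monom) (f u w : group_ring monom).

Definition texp (E : 'I_m -> int) : trop m := [ffun i => E i : tropZ].

Lemma trop_mulE (a b : trop m) i : ((a * b)%g i = (a i : int) + (b i : int) :> int)%R.
Proof. by rewrite ffunE. Qed.

Definition mon x g : S := chi g.1 * \prod_i x i ^z (g.2 i : int).

Lemma monM x : ghom (mon x).
Proof.
move=> g h; rewrite /mon chiM -[RHS]mulgA [X in _ = _ * X]mulgCA mulgA -big_split.
congr (_ * _); apply: eq_bigr => i _ /=.
by rewrite -expgzD; congr (_ ^z _); apply: trop_mulE.
Qed.

Lemma monE x p E : mon x (p, texp E) = chi p * \prod_i x i ^z E i.
Proof. by rewrite /mon; congr (_ * _); apply: eq_bigr => i _; rewrite ffunE. Qed.

Lemma v_neq0 a : v a != 0%R.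
Proof.
apply/eqP => a0; have := v1; rewrite -(mulgV a) vM a0 mul0r => /esym/eqP.
by rewrite oner_eq0.
Qed.

Lemma vV a : v a^-1 = (v a)^-1%R.
Proof. by apply: (mulIf (v_neq0 a)); rewrite mulVf ?v_neq0 // -vM mulVg. Qed.

Lemma vXn a n : v (a ^+ n) = (v a ^+ n)%R.
Proof. by elim: n => [|n IHn]; rewrite ?expg0 ?v1 // expgS exprS vM IHn. Qed.

Definition rho x : group_ring monom -> K := lin (v \o mon x).

Let vmonM x g h : (v \o mon x) (g * h) = ((v \o mon x) g * (v \o mon x) h)%R.
Proof. by rewrite /= monM vM. Qed.

Let vmon1 x : (v \o mon x) 1 = 1%R.
Proof. by rewrite /= (ghom1 (monM x)). Qed.

Lemma rhoM x : {morph rho x : f u / (f * u)%R}.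
Proof. exact: (linM (vmonM x)). Qed.

Lemma rho1 x : rho x 1%R = 1%R.
Proof. exact: (lin1 (vmon1 x)). Qed.

Lemma rhoD x : {morph rho x : f u / (f + u)%R}.
Proof. exact: linD. Qed.

Lemma rhoX x f n : rho x (f ^+ n)%R = (rho x f ^+ n)%R.
Proof. exact: (linX (vmonM x) (vmon1 x)). Qed.

Lemma rho_of x g : rho x (group_ring_of g) = v (mon x g).
Proof. exact: lin_of. Qed.

Lemma rhoU x g c : rho x (mkmalgU g c) = (c%:~R * v (mon x g))%R.
Proof. exact: linU. Qed.

Lemma rho_const x x' f :
  {in monalg.msupp f, forall g, g.2 = 1} -> rho x f = rho x' f.
Proof.
move=> f1; rewrite /rho /lin !monalg.mmapE big_seq [RHS]big_seq.
apply: eq_bigr => g /f1 g1; congr (_ * v _)%R; rewrite /mon g1.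
by rewrite !big1 // => i; rewrite ffunE.
Qed.

Definition laurent x z := exists f, z = rho x f.

Lemma laurent_mon x g : laurent x (v (mon x g)).
Proof. by exists (group_ring_of g); rewrite rho_of. Qed.

Lemma mon_var x i : mon x (1, texp (fun i' => (i' == i)%:R%R)) = x i.
Proof.
rewrite monE (ghom1 chiM) mul1g (bigD1 i) //= eqxx expgz1 big1 ?mulg1 //.
by move=> i' /negbTE->.
Qed.

Lemma laurentD x z z' : laurent x z -> laurent x z' -> laurent x (z + z')%R.
Proof. by move=> [f ->] [f' ->]; exists (f + f')%R; rewrite rhoD. Qed.

Lemma laurentM x z z' : laurent x z -> laurent x z' -> laurent x (z * z')%R.
Proof. by move=> [f ->] [f' ->]; exists (f * f')%R; rewrite rhoM. Qed.

Lemma laurent0 x : laurent x 0%R.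
Proof. by exists 0%R; rewrite /rho lin0. Qed.

Lemma laurent1 x : laurent x 1%R.
Proof. by exists 1%R; rewrite rho1. Qed.

Lemma laurentX x z n : laurent x z -> laurent x (z ^+ n)%R.
Proof. by move=> [f ->]; exists (f ^+ n)%R; rewrite rhoX. Qed.

Lemma laurent_int x (c : int) z : laurent x z -> laurent x (c%:~R * z)%R.
Proof.
move=> xz; apply: laurentM => //; exists (mkmalgU 1%g c : group_ring monom).
by rewrite rhoU (ghom1 (monM x)) v1 mulr1.
Qed.

(** A bound for the exponents that occur in [f], used to clear denominators. *)
Definition expbound f : nat :=
  (\sum_(g <- monalg.msupp f) \sum_i absz (g.2 i : int))%N.

Lemma expboundP f g i : g \in monalg.msupp f ->
  (0 <= (g.2 i : int) + (expbound f)%:Z)%R.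
Proof.
move=> gf; have : (absz (g.2 i : int) <= expbound f)%N.
  rewrite /expbound (bigD1_seq g) ?fset_uniq //= (bigD1 i) //=.
  by rewrite -addnA leq_addr.
by move: (g.2 i : int) => a; lia.
Qed.

Lemma v_expgz a (n : int) : (0 <= n)%R -> v (a ^z n) = (v a ^+ absz n)%R.
Proof. by case: n => // n _; rewrite -vXn. Qed.

Lemma v_prod (E : 'I_m -> S) : v (\prod_i E i) = (\prod_i v (E i))%R.
Proof. exact: (big_morph v vM v1). Qed.

(** A Laurent polynomial in [x'] becomes one in [x] after clearing the
    denominators [x' i], when these are themselves Laurent polynomials in [x]. *)
Lemma laurent_clear x x' z : (forall i, laurent x (v (x' i))) -> laurent x' z ->
  exists N, laurent x (z * \prod_i v (x' i) ^+ N)%R.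
Proof.
move=> xx' [f ->]; exists (expbound f).
rewrite /rho /lin monalg.mmapE mulr_suml big_seq.
apply: (big_ind (laurent x)) => [||g gf]; [exact: laurent0 | exact: laurentD |].
rewrite -mulrA; apply: laurent_int.
rewrite -(eq_bigr _ (fun i _ => vXn (x' i) _)) -v_prod -vM /mon.
rewrite -[X in v X]mulgA -big_split /= vM; apply: laurentM.
  rewrite (_ : chi g.1 = mon x (g.1, texp (fun=> 0%R))); first exact: laurent_mon.
  by rewrite monE big1 ?mulg1.
rewrite v_prod; apply: (big_ind (laurent x)) => [||i _].
- exact: laurent1.
- exact: laurentM.
- rewrite -[_ ^+ expbound f]/(x' i ^z (expbound f)%:Z) -expgzD.
  by rewrite v_expgz; [apply: laurentX | apply: expboundP].
Qed.

(** * Seeds whose cluster is free and whose exponent vectors are independent *)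

Definition yexp s j : monom := (sy s j, texp (fun i => sB s i j)).

Lemma mon_yexp s j : mon (sx s) (yexp s j) = yhat chi (sB s) (sy s) (sx s) j.
Proof. exact: monE. Qed.

(** Freeness of the cluster embeds its Laurent polynomial ring in [K];
    independence makes the exchange binomials [1 + yhat_j] pairwise coprime in
    it. Without the latter, the two denominators that the proof of the Laurent
    phenomenon compares could share a factor. *)
Record generic s : Prop := Generic {
  generic_inj : injective (rho (sx s));
  generic_skew : (sB s)^T%R = (- sB s)%R;
  generic_indep : forall n : 'I_m -> int, \prod_j sy s j ^z n j = 1 ->
    (forall i, \sum_j sB s i j * n j = 0)%R -> forall j, n j = 0%R
}.

Lemma rho_inj0 x : (forall f, rho x f = 0%R -> f = 0%R) -> injective (rho x).
Proof.
move=> x0 f u fu; apply/eqP; rewrite -subr_eq0; apply/eqP/x0.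
by rewrite /rho linB -!/(rho x _) fu subrr.
Qed.

(** The monomial cofactor of [yhat_k (+) 1] in the new variable [x_k']. *)
Definition xexp s k : monom :=
  ((sy s k (+) 1)^-1, texp (fun i => (pos_part (- sB s i k) - (i == k)%:R)%R)).

Lemma smut_var s k : sx (smut chi s k) k =
  (mon (sx s) (yexp s k) (+) 1) * mon (sx s) (xexp s k).
Proof.
rewrite /= mutx_yhat // mon_yexp; congr (_ * _); rewrite monE (ghomV chiM).
rewrite invgM [RHS]mulgC mulgA [in RHS](eq_bigr (fun i =>
  sx s i ^z pos_part (- sB s i k) * sx s i ^z (- (i == k)%:R))) => [|i _]; last first.
  by rewrite expgzD.
rewrite big_split /= [X in _ = _ * X * _](bigD1 k) //= eqxx expgzN expgz1.
rewrite [\prod_(i | i != k) _]big1 => [|i /negbTE-> //].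
by rewrite mulg1.
Qed.

Lemma smut_var_neq s k i : i != k -> sx (smut chi s k) i = sx s i.
Proof. by rewrite /= /mutx => /negbTE->. Qed.

(** The monomial that [g], read in the cluster mutated at [k], becomes in the
    old cluster once the binomials [1 + yhat_k] are split off; it negates the
    exponent at [k]. *)
Definition swap_exp s k g : monom :=
  (g.1 * (sy s k (+) 1) ^z (- (g.2 k : int))%R,
   texp (fun i => if i == k then (- (g.2 k : int))%R
     else ((g.2 i : int) + pos_part (- sB s i k) * (g.2 k : int))%R)).

Lemma mon_swap s k g : sB s k k = 0%R ->
  mon (sx (smut chi s k)) g
    = mon (sx s) (swap_exp s k g) * (mon (sx s) (yexp s k) (+) 1) ^z (g.2 k : int).
Proof.
move=> Bkk; rewrite {1}/mon; set x' := sx (smut chi s k).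
rewrite (bigD1 k) //= [x' k]smut_var expgMz.
rewrite (eq_bigr (fun i => sx s i ^z (g.2 i : int))) => [|i ik]; last first.
  by rewrite [x' i]smut_var_neq.
rewrite !monE chiM (ghomV chiM) (ghomz chiM).
rewrite [in RHS](bigD1 k) //= eqxx.
rewrite [\prod_(i | i != k) sx s i ^z (if i == k then _ else _)](eq_bigr (fun i =>
   sx s i ^z (g.2 i : int) * (sx s i ^z pos_part (- sB s i k)%R) ^z (g.2 k : int)));
  last first.
  by move=> i /negbTE->; rewrite expgzD expgzM.
rewrite big_split /= -prodgz.
rewrite [\prod_i sx s i ^z (_ - _)](bigD1 k) //= Bkk eqxx.
rewrite [\prod_(i | i != k) sx s i ^z (_ - _)](eq_bigr (fun i =>
   sx s i ^z pos_part (- sB s i k)%R)) => [|i /negbTE->]; last by rewrite subr0.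
rewrite [pos_part (- 0)](_ : _ = 0%R) //.
set a := _ (+) 1; set b := chi (_ (+) 1).
by abelian; ring.
Qed.

Lemma swap_exp_inj s k : injective (swap_exp s k).
Proof.
move=> [p a] [q b] [] /= pq /ffunP ab.
have abk : (a k = b k :> int)%R.
  by have := ab k; rewrite !ffunE eqxx => /(congr1 (fun z : int => - z)%R); rewrite !opprK.
have -> : a = b.
  apply/ffunP => i; have := ab i; rewrite !ffunE.
  by case: eqP => [->|_ /eqP]; rewrite ?abk // (inj_eq (addIr _)) => /eqP.
by congr pair; move: pq; rewrite abk => /mulIg.
Qed.

(** A Laurent relation in the mutated cluster, multiplied by a high power of
    [1 + yhat_k], is one in the old cluster in which the exponent of [x_k]
    tells the original terms apart. *)
Lemma generic_mut_inj s k : generic s -> injective (rho (sx (smut chi s k))).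
Proof.
move=> [s_inj sT _]; apply: rho_inj0 => f f0.
have Bkk := skew_diag k sT.
pose d g : int := g.2 k.
have dM g h : d (g * h) = (d g + d h)%R by apply: trop_mulE.
pose a : group_ring monom := (1 + group_ring_of (yexp s k))%R.
apply: (@graded_substitution _ d dM (swap_exp s k) a f (expbound f)).
- exact: swap_exp_inj.
- by move=> g; rewrite /d ffunE eqxx.
- by move=> g /supp1of[->|->]; rewrite /d ffunE.
- exact: one_add_of_neq0.
apply: s_inj; rewrite [RHS](_ : _ = 0%R); last exact: lin0.
have va : rho (sx s) a = v (mon (sx s) (yexp s k) (+) 1).
  by rewrite rhoD rho1 rho_of vD v1 addrC.
transitivity (rho (sx (smut chi s k)) f * rho (sx s) a ^+ expbound f)%R; last first.
  by rewrite f0 mul0r.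
rewrite {1}/rho lin_sum -/(rho (sx s)) {2}/rho /lin monalg.mmapE mulr_suml.
rewrite big_seq [RHS]big_seq; apply: eq_bigr => g gf.
rewrite rhoM rhoX rhoU -!mulrA; congr (_ * _)%R.
rewrite va -vXn -[in RHS]vXn -vM /= mon_swap // -vM -[in RHS]mulgA; congr (v (_ * _)).
rewrite -[_ ^+ expbound f]/(_ ^z (expbound f)%:Z) -expgzD addrC.
have := expboundP k gf; rewrite /d; case: (_ + _)%R => // n _.
Qed.

(** Mutation acts on the exponent vectors of the [yhat_j] as an invertible matrix,
    once the new variable is expressed by its leading monomial. *)
Lemma generic_mut s k : generic s -> generic (smut chi s k).
Proof.
move=> gs; have [_ sT s_indep] := gs; split; first exact: generic_mut_inj.
  exact: mutB_tr.
have Bkk := skew_diag k sT.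
move=> n prod_n sum_n.
(* The exponent vectors change by the elementary operation
   [e_j := e_j + [B k j]_+ e_k] and a sign, up to a term killed by [sum_k];
   [n'] is the dependency pulled back along it. *)
pose n' j : int := (if j == k then - n k + \sum_j pos_part (sB s k j) * n j else n j)%R.
have sum_k : (\sum_j sB s k j * n j = 0)%R.
  apply: oppr_inj; rewrite oppr0 -[RHS](sum_n k) -sumrN; apply: eq_bigr => j _.
  by rewrite /= mxE eqxx mulNr.
have sum_k' : (\sum_(j | j != k) sB s k j * n j = 0)%R.
  by rewrite -[RHS]sum_k [in RHS](bigD1 k) //= Bkk mul0r add0r.
have split_sum (E : 'I_m -> int) :
    (\sum_j E j * n' j = \sum_(j | j != k) E j * n j
       + E k * (- n k + \sum_j pos_part (sB s k j) * n j))%R.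
  rewrite (bigD1 k) //= /n' eqxx addrC; congr (_ + _)%R.
  by apply: eq_bigr => j /negbTE->.
have n'0 : forall j, n' j = 0%R.
  apply: s_indep => [|i].
    rewrite (bigD1 k) //= {1}/n' eqxx.
    rewrite (eq_bigr (fun j => sy s j ^z n j)) => [|j /negbTE jk]; last first.
      by rewrite /n' jk.
    rewrite -[RHS]prod_n [in RHS](bigD1 k) //= {1}/muty eqxx.
    rewrite [in RHS](eq_bigr (fun j => sy s j ^z n j * (sy s k ^z (pos_part (sB s k j) * n j)%R
        * (sy s k (+) 1) ^z (- (sB s k j * n j))%R))) => [|j /negbTE jk]; last first.
      by rewrite /muty jk; abelian; ring.
    rewrite !big_split /= -!prodgzr.
    rewrite [X in sy s k ^z X * _ = _](_ : _ = (- n k +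
        \sum_(j | j != k) pos_part (sB s k j) * n j)%R); last first.
      by rewrite (bigD1 k) //= Bkk mul0r add0r.
    rewrite sumrN sum_k' oppr0.
    by abelian; ring.
  rewrite split_sum.
  have [->|ik] := eqVneq i k.
    by rewrite Bkk mul0r addr0 sum_k'.
  rewrite -[RHS](sum_n i) [in RHS](bigD1 k) //= mxE eqxx orbT.
  rewrite [in RHS](eq_bigr (fun j => sB s i j * n j + (sB s i k * (pos_part (sB s k j) * n j)
     + pos_part (- sB s i k) * (sB s k j * n j))))%R => [|j jk]; last first.
    by rewrite mxE (negbTE ik) (negbTE jk) /=; ring.
  rewrite !big_split /= -!mulr_sumr.
  rewrite sum_k'.
  have -> : (\sum_j pos_part (sB s k j) * n j
      = \sum_(j | j != k) pos_part (sB s k j) * n j)%R.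
    by rewrite (bigD1 k) //= Bkk mul0r add0r.
  by ring.
have n0 j : j != k -> n j = 0%R by move=> /negbTE jk; have := n'0 j; rewrite /n' jk.
move=> j; have [->|/n0 //] := eqVneq j k.
have := n'0 k; rewrite /n' eqxx (bigD1 k) //= Bkk mul0r add0r big1 ?addr0.
  by move=> /eqP; rewrite oppr_eq0 => /eqP.
by move=> i /n0 ->; rewrite mulr0.
Qed.

End LaurentRing.

(** * The Laurent phenomenon *)

Section RegularModulo.
Variables (R : idomainType) (q : R).
Local Open Scope ring_scope.

(** [f] is a nonzerodivisor modulo [q]. *)
Definition regular f := forall u w, f * u = q * w -> exists w', u = q * w'.

Lemma regularM f f' : regular f -> regular f' -> regular (f * f').
Proof. by move=> fr f'r u w; rewrite -mulrA => /fr[w' /f'r]. Qed.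

Lemma regular1 : regular 1.
Proof. by move=> u w; rewrite mul1r => ->; exists w. Qed.

Lemma regularX f n : regular f -> regular (f ^+ n).
Proof.
move=> fr; elim: n => [|n IHn]; first exact: regular1.
by rewrite exprS; apply: regularM.
Qed.

Lemma regular_unit f f' : f' * f = 1 -> regular f.
Proof.
move=> ff' u w fu; exists (f' * w).
by rewrite mulrCA -fu mulrA ff' mul1r.
Qed.

Lemma regular_add1 a : regular (1 + q * a).
Proof.
by move=> u w; rewrite mulrDl mul1r => uw; exists (w - a * u); rewrite mulrBr -uw; ring.
Qed.

(** A fraction with denominator [q ^+ N] and also with a denominator regular
    modulo [q] has no denominator. *)
Lemma regular_exp f A B N : q != 0 -> regular f -> f * A = q ^+ N * B ->
  exists w, A = q ^+ N * w.
Proof.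
move=> q0 fr; elim: N A B => [|N IHN] A B.
  by move=> _; exists A; rewrite mul1r.
rewrite exprS -mulrA => fA; have [A' AE] := fr _ _ fA.
have [|w wP] := IHN A' B.
  by apply: (mulfI q0); rewrite -fA AE mulrCA.
by exists w; rewrite AE wP mulrA.
Qed.

End RegularModulo.

Section DualSeed.
Variables (P S : semifieldType) (chi : P -> S) (m : nat).
Hypothesis chiM : ghom chi.
Implicit Type s : sseed P S m.

(** Exchanging the two monomials of each exchange relation does not change the
    cluster variables. *)
Definition dual s : sseed P S m :=
  SSeed (sx s) (fun j => (sy s j)^-1) (- sB s)%R.

Lemma dual_smut s k : smut chi (dual s) k = dual (smut chi s k).
Proof.
apply: sseed_eq => /= [j|j|]; last exact: mutBN.
- rewrite /mutx; case: eqP => // _.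
  rewrite invg_oplus1 chiM !(ghomV chiM).
  rewrite (eq_bigr (fun i => sx s i ^z pos_part (- sB s i k)%R)) => [|i _]; last first.
    by rewrite mxE.
  rewrite [X in _ (+) X](eq_bigr (fun i => sx s i ^z pos_part (sB s i k))) => [|i _].
    set A := \prod_i _; set C := \prod_i _.
    have -> : ((chi (sy s k))^-1 * A) (+) C = (chi (sy s k) * C (+) A) / chi (sy s k).
      by rewrite oplusC mulg_oplusl; congr (_ (+) _); abelian; ring.
    by set D := _ (+) A; abelian; ring.
  by rewrite mxE opprK.
- rewrite /muty; case: eqP => // _; rewrite mxE invg_oplus1 opprK.
  have -> : (pos_part (- sB s k j) = pos_part (sB s k j) - sB s k j)%R.
    by rewrite -{3}(pos_partB (sB s k j)); ring.
  by abelian; ring.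
Qed.

End DualSeed.

Section LaurentPhenomenon.
Variables (P S : semifieldType) (chi : P -> S) (K : fieldType) (v : S -> K) (m : nat).
Hypothesis chiM : ghom chi.
Hypothesis vM : forall a b, v (a * b) = (v a * v b)%R.
Hypothesis vD : forall a b, v (a (+) b) = (v a + v b)%R.
Hypothesis v1 : v 1 = 1%R.

Implicit Types (s : sseed P S m) (j k : 'I_m).

Local Notation G := (monom P m).
Local Notation laurent := (@laurent P S chi K v m).
Local Notation rho := (@rho P S chi K v m).
Local Notation generic := (@generic P S chi K v m).
Local Notation mu := (@smut P S chi m).

Lemma generic_dual s : generic s -> generic (dual s).
Proof.
move=> [s_inj sT s_indep]; split=> //=.
  by rewrite linearN /= sT.
move=> n prod_n sum_n j; apply: oppr_inj; rewrite oppr0.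
apply: (s_indep (fun j => - n j)%R) => [|i].
  rewrite -[RHS]prod_n; apply: eq_bigr => i _.
  by rewrite expVgz expgzN.
by rewrite -[RHS](sum_n i); apply: eq_bigr => i' _; rewrite !mxE mulrN mulNr.
Qed.

Lemma laurent_var x i : laurent x (v (x i)).
Proof. by rewrite -(mon_var chiM x i); apply: laurent_mon. Qed.

(** In rank two: after [j], [k], [j] the new variables are, up to monomials,
    [q = 1 + Y_j], [Q = 1 + Y_k q^c] and [R = (Y_j + Q^c) / q]. All are
    polynomials in the [Y], and [Q] and [R] are prime to [q], being [1], or
    [1 + Y_k], or congruent to [1] modulo [q]. The sign of [B j k] decides
    which monomials occur; the other sign follows by duality. *)
Section Exchange.
Variables (s : sseed P S m) (j k : 'I_m).
Hypotheses (s_generic : generic s) (jk : j != k) (Bjk : (sB s j k <= 0)%R).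

Let x := sx s.
Let s1 := mu s j.
Let s2 := mu s1 k.
Let s3 := mu s2 j.
Let Yj : group_ring G := group_ring_of (yexp s j).
Let Yk : group_ring G := group_ring_of (yexp s k).
Let q : group_ring G := (1 + Yj)%R.
Let c := absz (sB s j k).
Let s_inj := generic_inj s_generic.
Let sT := generic_skew s_generic.

Let q_neq0 : q != 0%R.
Proof. exact: one_add_of_neq0. Qed.

Let regular_mon g : regular q (group_ring_of g).
Proof.
apply: (@regular_unit _ _ _ (group_ring_of g^-1)).
by rewrite -group_ring_ofM mulVg.
Qed.

(* Independence of the exponent vectors enters here. *)
Let regular_Yk : regular q (1 + Yk)%R.
Proof.
move=> u w uw; apply: coprime_1of uw => n p npE.
have [_ _ s_indep] := s_generic.
(* [N] is the dependency n e_k + p e_j. *)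
pose N i : int := (if i == k then n else if i == j then p else 0)%R.
have sum2 (T : Type) (idx : T) (op : Monoid.com_law idx) (E : 'I_m -> T) :
    (forall i, i != k -> i != j -> E i = idx) -> \big[op/idx]_i E i = op (E k) (E j).
  move=> E0; rewrite (bigD1 k) //= (bigD1 j) //= big1 ?Monoid.mulm1 //.
  by move=> i /andP[ik ij]; apply: E0.
have := s_indep N; rewrite sum2 => [sN|i ik ij]; last first.
  by rewrite /N (negbTE ik) (negbTE ij).
have Nk : N k = n by rewrite /N eqxx.
have Nj : N j = p by rewrite /N (negbTE jk) eqxx.
have fstz (g : G) (z : int) : (g ^z z).1 = g.1 ^z z.
  exact: (ghomz (f := fst : G -> P)).
have sndz (g : G) (z : int) i : ((g ^z z).2 i : int) = ((g.2 i : int) * z)%R.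
  pose f (h : G) : tropZ := h.2 i.
  have fM : ghom f by move=> g1 g2; rewrite /f ffunE.
  by rewrite -[LHS]/(f (g ^z z)) (ghomz fM) tropZ_expgz.
rewrite -Nk; apply: sN => [|i].
  rewrite Nk Nj -[RHS]/((1 : G).1) -npE.
  by rewrite -[RHS]/((yexp s k ^z n).1 * (yexp s j ^z p).1) !fstz.
rewrite sum2 => [|i' i'k i'j]; last by rewrite /N (negbTE i'k) (negbTE i'j) mulr0.
rewrite Nk Nj; have := congr1 (fun g : G => g.2 i : int) npE.
by rewrite /= trop_mulE !sndz !ffunE.
Qed.

(* [T] is the geometric sum for which [Q ^+ c - 1 = (Q - 1) * T]. *)
Let Q : group_ring G := (1 + Yk * q ^+ c)%R.
Let T : group_ring G := (\sum_(i < c) Q ^+ i)%R.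
Let R : group_ring G := (if c is c'.+1 then 1 + Yk * q ^+ c' * T else 1)%R.

Let QR : (Yj + Q ^+ c = q * R)%R.
Proof.
rewrite /R /T; case cE: c => [|c']; first by rewrite expr0 mulr1 addrC.
have /eqP := subrX1 Q c'.+1; rewrite subr_eq => /eqP->.
set T' := (\sum_(i < _) _)%R.
have -> : (Q - 1 = Yk * (q * q ^+ c'))%R by rewrite /Q cE exprS addrC addKr.
by rewrite /q; ring.
Qed.

Let regular_Q : regular q Q.
Proof.
rewrite /Q; case: c => [|c']; first by rewrite expr0 mulr1; apply: regular_Yk.
by rewrite exprS mulrCA; apply: regular_add1.
Qed.

Let regular_R : regular q R.
Proof.
rewrite /R /T; case: c => [|[|c']]; first exact: regular1.
- by rewrite expr0 mulr1 big_ord1 expr0 mulr1; apply: regular_Yk.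
- by rewrite exprS [(Yk * _)%R]mulrCA -mulrA; apply: regular_add1.
Qed.

Let cE : (sB s j k = - c%:Z)%R.
Proof. by rewrite /c; lia. Qed.

Let Bkj : sB s k j = c.
Proof. by have /matrixP/(_ j k) := sT; rewrite !mxE cE; move: (sB s k j) => a; lia. Qed.

Let Bjj : sB s j j = 0%R.
Proof. exact: skew_diag. Qed.

Let Bkk : sB s k k = 0%R.
Proof. exact: skew_diag. Qed.

Let kj : k != j.
Proof. by rewrite eq_sym. Qed.

Let rho_q : rho x q = v (mon chi x (yexp s j) (+) 1).
Proof. by rewrite rhoD rho1 // rho_of vD v1 addrC. Qed.

Let yhat1 : yhat chi (sB s1) (sy s1) (sx s1) =1 muty (sB s) j (yhat chi (sB s) (sy s) x).
Proof. exact: yhat_mut. Qed.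

Let B1jk : sB s1 j k = c.
Proof. by rewrite /= mxE eqxx cE opprK. Qed.

Let B1kj : sB s1 k j = (- c%:Z)%R.
Proof. by rewrite /= mxE eqxx orbT Bkj. Qed.

Let B1kk : sB s1 k k = 0%R.
Proof. by apply: skew_diag; apply: mutB_tr. Qed.

Let yhat1k : v (yhat chi (sB s1) (sy s1) (sx s1) k (+) 1) = rho x Q.
Proof.
rewrite yhat1 /muty (negbTE kj) cE pos_part_eq0; last by lia.
rewrite expgz0 mulg1 opprK vD v1 vM [v (_ ^z _)]vXn // -!mon_yexp -rho_q -rho_of.
by rewrite -rhoX // -rhoM // addrC /Q rhoD rho1.
Qed.

Let var1 : sx s1 j = (mon chi x (yexp s j) (+) 1) * mon chi x (xexp s j).
Proof. exact: smut_var. Qed.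

Let var3k : exists g, v (sx s3 k) = rho x (Q * group_ring_of g)%R.
Proof.
exists ((sy s1 k (+) 1)^-1, texp (fun i => (pos_part (- sB s1 i k) - (i == k)%:R)%R)).
rewrite smut_var_neq // smut_var // vM mon_yexp yhat1k rhoM // rho_of; congr (_ * v _)%R.
rewrite /xexp !monE; congr (_ * _); apply: eq_bigr => i _.
have [->|ij] := eqVneq i j; last by rewrite smut_var_neq.
by rewrite B1jk pos_part_eq0 ?(negbTE jk) ?subr0 //; lia.
Qed.

Let var3j : exists g, v (sx s3 j) = rho x (R * group_ring_of g)%R.
Proof.
pose W : G := ((sy s2 j (+) 1)^-1, texp (fun i => pos_part (- sB s2 i j)%R)).
exists (W / (yexp s j * xexp s j)).
have B2kj : sB s2 k j = c by rewrite /= mxE eqxx -/(sB s1) B1kj opprK.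
have B2jj : sB s2 j j = 0%R by apply: skew_diag; do 2!apply: mutB_tr.
have x2j : sx s2 j = sx s1 j by apply: smut_var_neq.
have WE : mon chi (sx s2) W = mon chi x W.
  rewrite !monE; congr (_ * _); apply: eq_bigr => i _.
  have [->|ik] := eqVneq i k; first by rewrite B2kj pos_part_eq0 ?expgz0 //; lia.
  have [->|ij] := eqVneq i j; first by rewrite B2jj !expgz0.
  by rewrite smut_var_neq // smut_var_neq.
have x3jE : sx s3 j * sx s1 j = (yhat chi (sB s2) (sy s2) (sx s2) j (+) 1) * mon chi x W.
  rewrite -x2j -WE /= mutx_yhat // monE (ghomV chiM).
  set a := _ (+) 1; set b := chi (_ (+) 1).
  by abelian; ring.
have y2j : yhat chi (sB s2) (sy s2) (sx s2) j =
    (mon chi x (yexp s j))^-1 * (yhat chi (sB s1) (sy s1) (sx s1) k (+) 1) ^z c.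
  rewrite yhat_mut // /muty (negbTE jk) -/(sB s1) B1kj opprK pos_part_eq0; last by lia.
  by rewrite expgz0 mulg1 yhat1 {1}/muty eqxx mon_yexp.
have E : (v (sx s3 j) * v (mon chi x (yexp s j * xexp s j)%g) = rho x R * v (mon chi x W))%R.
  apply: (mulIf (v_neq0 vM v1 (mon chi x (yexp s j) (+) 1))).
  rewrite mulrAC [RHS]mulrAC -!vM.
  have -> : sx s3 j * (mon chi x (yexp s j) (+) 1) * mon chi x (yexp s j * xexp s j)
      = (sx s3 j * sx s1 j) * mon chi x (yexp s j).
    by rewrite var1 monM //; set a := _ (+) 1; abelian; ring.
  rewrite x3jE y2j mulgC mulgA mulg_oplusr mulVKg mulg1 vM vD [v (_ ^z _)]vXn // yhat1k.
  rewrite -rho_of -/Yj -rhoX // -rhoD [X in rho x X]addrC QR rhoM // rho_q.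
  by congr (_ * _)%R; apply: mulrC.
rewrite rhoM // rho_of monM // (ghomV (monM chiM x)) vM vV // mulrA -E.
by rewrite mulfK // v_neq0.
Qed.

(** Clearing denominators writes [z] as a Laurent polynomial over a power of [q],
    and also over a product of powers of [Q] and [R]; those are coprime. *)
Lemma laurent_exchange z : laurent (sx s1) z -> laurent (sx s3) z -> laurent x z.
Proof.
move=> z1 z3.
have x1 i : laurent x (v (sx s1 i)).
  have [->|ij] := eqVneq i j; last by rewrite smut_var_neq //; apply: laurent_var.
  by rewrite var1 vM -rho_q; apply: laurentM => //; [exists q | apply: laurent_mon].
have x3 i : exists2 F, v (sx s3 i) = rho x F & regular q F.
  have [->|ij] := eqVneq i j.
    have [g gP] := var3j; exists (R * group_ring_of g)%R => //.
    exact: regularM.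
  have [->|ik] := eqVneq i k.
    have [g gP] := var3k; exists (Q * group_ring_of g)%R => //.
    exact: regularM.
  rewrite smut_var_neq // smut_var_neq // smut_var_neq // -(mon_var chiM (sx s) i).
  by rewrite -rho_of; eexists; [reflexivity | apply: regular_mon].
have [N1 [f1 f1P]] := laurent_clear chiM vM v1 x1 z1.
have [|N3 [f3 f3P]] := laurent_clear chiM vM v1 _ z3 (x := x).
  by move=> i; have [F FP _] := x3 i; exists F.
have [F3 F3P F3r] : exists2 F, (\prod_i v (sx s3 i) ^+ N3)%R = rho x F & regular q F.
  apply: (big_ind (fun z => exists2 F, z = rho x F & regular q F)) => [||i _].
  - by exists 1%R; [rewrite rho1 | apply: regular1].
  - move=> _ _ [F -> Fr] [F' -> F'r]; exists (F * F')%R; first by rewrite rhoM.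
    exact: regularM.
  - by have [F -> Fr] := x3 i; exists (F ^+ N3)%R; [rewrite rhoX | apply: regularX].
have [g gP] : exists g, (\prod_i v (sx s1 i) ^+ N1)%R = rho x (q ^+ N1 * group_ring_of g)%R.
  pose g0 : G := (1, texp (fun i => (i != j)%:R%R)).
  exists ((g0 * xexp s j) ^+ N1).
  rewrite prodrXl rhoM // rhoX // rho_of.
  rewrite -[_ ^+ N1]/((g0 * xexp s j) ^z N1%:Z) (ghomz (monM chiM x)).
  rewrite [v (_ ^z _)](vXn vM v1) -exprMn; congr (_ ^+ _)%R.
  rewrite rho_q monM // vM mulrCA; set E := (_ * v (mon chi x (xexp s j)))%R.
  transitivity (v (\prod_i sx s1 i)); first by rewrite v_prod.
  rewrite (bigD1 j) //= vM [mutx _ _ _ _ _ _]var1 vM -/E mulrC; congr (_ * _)%R.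
  rewrite /g0 monE (ghom1 chiM) mul1g [in RHS](bigD1 j) //= eqxx expgz0 mul1g; congr (v _).
  by apply: eq_bigr => i ij; rewrite ij expgz1 /mutx (negbTE ij).
have [|w wP] := @regular_exp _ q F3 (f1 * group_ring_of (g^-1)%g)%R
    (f3)%R N1 q_neq0 F3r.
  apply: s_inj; rewrite -/x !rhoM // -f1P -f3P F3P gP !rhoM //.
  have := v_neq0 vM v1 (mon chi x g).
  rewrite !rho_of (ghomV (monM chiM x)) vV // => g0.
  by field.
exists w; apply: (mulIf (x := rho x (q ^+ N1))%R).
  by rewrite rhoX // expf_eq0 negb_and rho_q v_neq0 // orbT.
rewrite [RHS]mulrC -[RHS](rhoM chiM vM) -wP rhoM // -f1P gP rhoM // !rho_of.
rewrite (ghomV (monM chiM x)) vV //.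
by have := v_neq0 vM v1 (mon chi x g) => g0; field.
Qed.

End Exchange.

Lemma laurent_exchange_skew s j k z : generic s -> j != k ->
  laurent (sx (mu s j)) z -> laurent (sx (mu (mu (mu s j) k) j)) z ->
  laurent (sx s) z.
Proof.
move=> sg jk z1 z3; have [Bjk|Bjk] := leP (sB s j k) 0%R.
  exact: (laurent_exchange sg jk Bjk).
have := @laurent_exchange (dual s) j k (generic_dual sg) jk; rewrite !dual_smut //=.
by apply; rewrite // mxE oppr_le0 ltW.
Qed.

(** A mutation walk leaving [s] along [j] and then [k] is seen from the seeds
    reached by [j] and by [j, k, j] as a shorter walk. *)
Theorem laurent_phenomenon s ks i : generic s ->
  laurent (sx s) (v (sx (walk chi s ks) i)).
Proof.
elim: {ks}(size ks) {-2}ks (leqnn (size ks)) s => [|n IHn] ks.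
  by rewrite leqn0 size_eq0 => /eqP-> s _; apply: laurent_var.
case: ks => [_ s _|j [_ s sg|k ks]]; first exact: laurent_var.
  have [->|ij] := eqVneq i j; last first.
    by rewrite [sx _ i]smut_var_neq //; apply: laurent_var.
  rewrite [sx _ j]smut_var // vM; apply: laurentM => //; last exact: laurent_mon.
  rewrite vD v1; apply: laurentD => //; first exact: laurent_mon.
  exact: laurent1.
rewrite /= ltnS => ks_n s sg.
have Bll t l : generic t -> sB t l l = 0%R by case=> _ tT _; apply: skew_diag.
have [jk|jk] := eqVneq j k.
  by rewrite -jk smutK ?Bll //; apply: IHn => //; apply: ltnW.
have g1 : generic (mu s j) by apply: generic_mut.
have g2 : generic (mu (mu s j) k) by apply: generic_mut.
apply: (laurent_exchange_skew sg jk).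
  exact: (IHn (k :: ks)).
have := IHn (j :: ks) ks_n (mu (mu (mu s j) k) j) (generic_mut chiM vM vD v1 _ g2).
by rewrite /= smutK ?Bll.
Qed.

End LaurentPhenomenon.

(** * The free model of a cluster algebra *)

Section FreeModel.
Variables (P : semifieldType) (m : nat) (K : fieldType).
Variable e : embedding (monom P m) K.
Implicit Types (p : P) (g : monom P m) (y : 'I_m -> P) (B : 'M[int]_m).

Definition free_chi p : posfrac e := pf_emb e (p, 1).

Definition var_exp i : monom P m := (1, texp (fun i' => (i' == i)%:R%R)).

Definition free_var i : posfrac e := pf_emb e (var_exp i).

Definition free_seed y B : sseed P (posfrac e) m := SSeed free_var y B.

Lemma free_chiM : ghom free_chi.
Proof. by move=> p p'; rewrite -pf_embM; congr pf_emb; congr pair; rewrite mulg1. Qed.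

(** A homomorphism on Laurent monomials is evaluation at the images of the
    coefficients and of the variables. *)
Lemma mon_universal (S : semifieldType) (phi : monom P m -> S) g : ghom phi ->
  mon (fun p => phi (p, 1)) (fun i => phi (var_exp i)) g = phi g.
Proof.
move=> phiM; rewrite /mon.
have -> : \prod_i phi (var_exp i) ^z (g.2 i : int)
    = phi (\prod_i var_exp i ^z (g.2 i : int)).
  by rewrite (ghom_prod phiM); apply: eq_bigr => i _; rewrite (ghomz phiM).
rewrite -phiM; congr (phi _); set h := \prod_i _.
have h1 : h.1 = 1.
  rewrite /h (ghom_prod (f := fst : monom P m -> P)) //; apply: big1 => i _.
  by rewrite (ghomz (f := fst : monom P m -> P)) // exp1gz.
have h2 i : h.2 i = g.2 i.
  pose f (g' : monom P m) : tropZ := g'.2 i.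
  have fM : ghom f by move=> g1 g2; rewrite /f ffunE.
  rewrite -[LHS]/(f h) /h (ghom_prod fM).
  rewrite (eq_bigr (fun j => if j == i then g.2 j else 1)) => [|j _].
    by rewrite -big_mkcond big_pred1_eq.
  rewrite (ghomz fM) [LHS]tropZ_expgz /f ffunE eq_sym.
  by case: eqP => [->|_]; [apply: mul1r | apply: mul0r].
clearbody h; case: g h h1 h2 => p a [p' b] /= -> ba.
congr pair; first exact: mulg1.
by apply/ffunP => i; rewrite -[LHS]/((1 * b) i) mul1g ba.
Qed.

Lemma mon_free g : mon free_chi free_var g = pf_emb e g.
Proof. exact: (mon_universal g (@pf_embM _ _ e)). Qed.

Lemma rho_free f : rho free_chi (@pf_val _ _ e) free_var f = lin e f.
Proof.
rewrite /rho /lin !monalg.mmapE; apply: eq_bigr => g _.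
by rewrite /= mon_free.
Qed.

(** The cluster variables of the free model are subtraction-free, so an
    equality between two of them holds wherever the initial cluster and the
    coefficients are mapped. *)
Section Transfer.
Variables (P' S' : semifieldType) (chi' : P' -> S') (pi : P -> P') (a : 'I_m -> S').
Hypotheses (chi'M : ghom chi') (pi_hom : sfhom pi).

Let phi := mon (chi' \o pi) a.

Let phiM : ghom phi.
Proof. by apply: monM => p p' /=; rewrite pi_hom.1 chi'M. Qed.

Definition specialize : posfrac e -> S' := pf_ext phi.

Lemma specialize_hom : sfhom specialize.
Proof. exact: pf_ext_hom. Qed.

Lemma specialize_chi p : specialize (free_chi p) = chi' (pi p).
Proof.
rewrite /specialize pf_ext_emb // /phi /mon /= big1 ?mulg1 // => i.
by rewrite ffunE.
Qed.

Lemma specialize_var i : specialize (free_var i) = a i.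
Proof.
rewrite /specialize pf_ext_emb //; apply: mon_var => p p' /=.
by rewrite pi_hom.1 chi'M.
Qed.

Lemma specialize_walk y B ks :
  smap pi specialize (walk free_chi (free_seed y B) ks)
    = walk chi' (SSeed a (pi \o y) B) ks.
Proof.
rewrite -(walk_map pi_hom specialize_hom (chi' := chi')) => [|p]; last first.
  by rewrite specialize_chi.
congr walk; apply: sseed_eq => // i; exact: specialize_var.
Qed.

Lemma specialize_eq y B ks i ls j :
  sx (walk free_chi (free_seed y B) ks) i = sx (walk free_chi (free_seed y B) ls) j ->
  sx (walk chi' (SSeed a (pi \o y) B) ks) i
    = sx (walk chi' (SSeed a (pi \o y) B) ls) j.
Proof. by move=> E; rewrite -!specialize_walk /= E. Qed.

End Transfer.

End FreeModel.

(** * Tropical cluster variables *)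

Section Tropical.
Variable m : nat.
Implicit Types (B : 'M[int]_m) (a : 'I_m -> trop m) (ks : seq 'I_m).

Lemma trop_oplus1 : 1 (+) 1 = 1 :> trop m.
Proof. by apply/ffunP => i; rewrite !ffunE; apply: minxx. Qed.

Lemma const1_hom (P : semifieldType) : sfhom (fun _ : P => 1 : trop m).
Proof. by split=> p p'; rewrite ?mulg1 ?trop_oplus1. Qed.

Lemma id_hom (P : semifieldType) : sfhom (@idfun P).
Proof. by []. Qed.

(** The evolution over the tropical semifield with trivial coefficients. It depends
    on the matrix alone, and so carries information from one coefficient
    semifield to another. *)
Definition trop_walk a B ks :=
  walk (@idfun (trop m)) (SSeed a (fun=> 1) B) ks.

Lemma trop_walk_y a B ks : sy (trop_walk a B ks) = fun=> 1.
Proof.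
rewrite /trop_walk; elim: ks a B => [//|k ks IHks] a B /=.
set s := smut _ _ _; have sy1 : sy s = fun=> 1.
  apply/funext => j; rewrite /= /muty trop_oplus1 !exp1gz !mulg1 invg1.
  by case: ifP.
by have := IHks (sx s) (sB s); rewrite -sy1; case: (s).
Qed.

Lemma walk_sB (P S P' S' : semifieldType) (chi : P -> S) (chi' : P' -> S')
    (s : sseed P S m) (s' : sseed P' S' m) ks :
  sB s = sB s' -> sB (walk chi s ks) = sB (walk chi' s' ks).
Proof.
by elim: ks s s' => [//|k ks IHks] s s' ss'; apply: IHks => /=; rewrite ss'.
Qed.

(** The initial tropical point for which the walk [ks] ends at the cluster [a']. *)
Definition trop_back a' B ks : 'I_m -> trop m :=
  sx (walk (@idfun (trop m)) (SSeed a' (fun=> 1) (sB (trop_walk a' B ks))) (rev ks)).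

Lemma trop_backK a' B ks : (B^T = - B)%R ->
  sx (trop_walk (trop_back a' B ks) B ks) = a'.
Proof.
move=> BT; pose B' := sB (trop_walk a' B ks).
have B'T : (B'^T = - B')%R by apply: walk_skew.
have BB' : sB (trop_walk a' B' (rev ks)) = B.
  rewrite (@walk_sB _ _ _ _ _ idfun _ (trop_walk a' B ks)) // /trop_walk walkK //.
rewrite -{2}[a']/(sx (SSeed a' (fun=> 1 : trop m) B')); congr sx.
rewrite -[RHS](walkK (rev ks) (chi := idfun)) // revK /trop_walk; congr walk.
apply: sseed_eq => [//|j|]; last exact: esym.
by rewrite -/(trop_walk a' B' (rev ks)) trop_walk_y.
Qed.

(** Tropical evaluation reads off the lowest degree of a positive sum, since
    positive terms cannot cancel. *)
Lemma ev_tropP (G : semifieldType) (h : G -> trop m) (l : seq G) r : l != [::] ->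
  (exists2 g, g \in l & h g r = ev h l r) /\
  {in l, forall g, ((ev h l r : int) <= (h g r : int))%R}.
Proof.
elim: l => [//|g l IHl] _; have [->|l0] := eqVneq l [::].
  rewrite ev1; split; first by exists g; rewrite ?mem_head.
  by move=> g'; rewrite mem_seq1 => /eqP->.
have [[g0 g0l g0E] lP] := IHl l0.
have evE : (ev h (g :: l) r = Num.min (h g r : int) (ev h l r : int) :> int)%R.
  by rewrite -cat1s ev_cat // ev1 ffunE.
rewrite evE; split.
  have [hl|lh] := leP (h g r : int) (ev h l r : int).
    by exists g; rewrite ?mem_head.
  by exists g0; rewrite // in_cons g0l orbT.
move=> g'; rewrite in_cons ge_min => /orP[/eqP->|/lP ->]; last by rewrite orbT.
by rewrite lexx.
Qed.

End Tropical.

(** * Positive expansions in an arbitrary cluster *)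

Section PositiveExpansion.
Variables (P S : semifieldType) (chi : P -> S) (m : nat).
Hypothesis chiM : ghom chi.
Variable x : 'I_m -> S.

Let M := monM (m := m) chiM x.

(** Subtraction-free in the cluster [x], which need not be the initial one. *)
Definition positive_expansion z := exists l l',
  [/\ l != [::], l' != [::] & z * ev (mon chi x) l' = ev (mon chi x) l].

Let posM a b : positive_expansion a -> positive_expansion b -> positive_expansion (a * b).
Proof.
move=> [l1 [l2 [l1n l2n al]]] [l3 [l4 [l3n l4n bl]]].
exists (lmul l1 l3), (lmul l2 l4); rewrite !lmul_nnil // !ev_lmul // -al -bl.
by split=> //; abelian; ring.
Qed.

Let posV a : positive_expansion a -> positive_expansion a^-1.
Proof.
by move=> [l [l' [ln l'n al]]]; exists l', l; split=> //; rewrite -al; abelian; ring.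
Qed.

Let posD a b : positive_expansion a -> positive_expansion b -> positive_expansion (a (+) b).
Proof.
move=> [l1 [l2 [l1n l2n al]]] [l3 [l4 [l3n l4n bl]]].
exists (lmul l1 l4 ++ lmul l3 l2), (lmul l2 l4).
rewrite !lmul_nnil // ev_cat ?lmul_nnil // !ev_lmul // -al -bl; split=> //.
  by case: (lmul l1 l4) (lmul_nnil l1n l4n).
by rewrite mulg_oplusl; congr (_ (+) _); abelian; ring.
Qed.

Let pos_mon g : positive_expansion (mon chi x g).
Proof. by exists [:: g], [:: 1]; rewrite !ev1 (ghom1 M) mulg1. Qed.

Let posz a n : positive_expansion a -> positive_expansion (a ^z n).
Proof.
have pos1 : positive_expansion 1 by rewrite -(ghom1 M).
move=> pa; have posX k : positive_expansion (a ^+ k).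
  by elim: k => [|k IHk]; [rewrite expg0 | rewrite expgS; apply: posM].
by case: n => n; [apply: posX | apply/posV/posX].
Qed.

Let pos_prod (E : 'I_m -> S) : (forall i, positive_expansion (E i)) ->
  positive_expansion (\prod_i E i).
Proof.
move=> pE; apply: (big_ind positive_expansion) => [|a b|i _].
- by rewrite -(ghom1 M).
- exact: posM.
- exact: pE.
Qed.

Let pos_chi p : positive_expansion (chi p).
Proof.
by have := pos_mon (p, texp (fun=> 0%R)); rewrite monE big1 ?mulg1.
Qed.

Lemma walk_positive (s : sseed P S m) ks i : sx s = x ->
  positive_expansion (sx (walk chi s ks) i).
Proof.
move=> sxE; have : forall j, positive_expansion (sx s j).
  by move=> j; rewrite sxE -(mon_var chiM x j).
elim: ks s {sxE} i => [|k ks IHks] s i px; first exact: px.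
apply: IHks => j; rewrite /= /mutx; case: ifP => // _.
apply: (posM _ (posV _)); last by apply: posM.
by apply: posD; [apply: posM => // |]; apply: pos_prod => i'; apply: posz.
Qed.

End PositiveExpansion.

(** * From tropical equality to equality with coefficients *)

(** A field that contains a given group ring: its fraction field. *)
Section FractionModel.
Variable G : semifieldType.
Local Open Scope ring_scope.

Definition frac_emb (g : G) : {fraction group_ring G} :=
  FracField.tofrac (group_ring_of g).

Lemma frac_embM g g' : frac_emb (g * g')%g = frac_emb g * frac_emb g'.
Proof. by rewrite /frac_emb group_ring_ofM rmorphM. Qed.

Lemma mkmalgU_int g (c : int) :
  mkmalgU g c = group_ring_of g *~ c :> group_ring G.
Proof. by rewrite -[c in LHS]intz; exact: (raddfMz (@mkmalgU G int g)). Qed.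

Lemma lin_frac f : lin frac_emb f = FracField.tofrac f.
Proof.
rewrite [f in RHS]group_ringE rmorph_sum /lin monalg.mmapE; apply: eq_bigr => g _.
by rewrite mkmalgU_int rmorphMz mulrzl.
Qed.

Lemma frac_emb_inj : injective (lin frac_emb).
Proof. by move=> f f'; rewrite !lin_frac => /eqP; rewrite tofrac_eq => /eqP. Qed.

Definition frac_embedding := Embedding frac_embM frac_emb_inj.

End FractionModel.

(** The denominators of the exchange relations are chosen so that the cluster
    in which all variables equal [1] is preserved by mutation. *)
Lemma walk_one (P : semifieldType) m (y : 'I_m -> P) (B : 'M[int]_m) ks :
  sx (walk (@idfun P) (SSeed (fun=> 1) y B) ks) = fun=> 1.
Proof.
have mut1 (s : sseed P P m) k : sx s = (fun=> 1) -> sx (smut idfun s k) = fun=> 1.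
  move=> s1; apply/funext => j /=; rewrite /mutx s1.
  by rewrite !big1 ?mulg1 ?mulgV ?if_same // => i _; rewrite exp1gz.
have : sx (SSeed (fun=> 1 : P) y B) = fun=> 1 by [].
by elim: ks (SSeed _ _ _) => [//|k ks IHks] s s1; apply/IHks/mut1.
Qed.

Section GenericCoefficients.
Variables (P : semifieldType) (m : nat) (B : 'M[int]_m) (y : 'I_m -> P).
Hypothesis BT : (B^T = - B)%R.

(** Principal coefficients are adjoined, which makes the exponent vectors of
    the [yhat_j] independent. *)
Definition coef : semifieldType := (P * trop m)%type.

Definition coef_y j : coef := (y j, texp (fun i => (i == j)%:R%R)).

Variables (K : fieldType) (e : embedding (monom coef m) K).

Let S : semifieldType := posfrac e.
Let chi : coef -> S := free_chi e.
Let v : S -> K := @pf_val _ _ e.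
Let s0 : sseed coef S m := free_seed e coef_y B.
Let chiM : ghom chi := @free_chiM _ _ _ e.
Let vM a b : v (a * b) = (v a * v b)%R := pf_valM a b.
Let vD a b : v (a (+) b) = (v a + v b)%R := pf_valD a b.
Let v1 : v 1 = 1%R := pf_val1 e.

Local Notation rho := (@rho coef S chi _ v m).
Local Notation coeff := (@monalg.mcoeff (monom coef m) int).
Local Notation supp := (@monalg.msupp (monom coef m) int).

Let generic0 : generic chi v s0.
Proof.
split=> //.
  by apply: rho_inj0 => f; rewrite rho_free -(lin0 e) => /emb_inj.
move=> n yn _ j; have := congr1 (fun p : coef => p.2 j : int) yn => /=.
pose f (p : coef) : tropZ := p.2 j.
have fM : ghom f by move=> p p'; rewrite /f ffunE.
rewrite -/(f _) (ghom_prod fM) (eq_bigr (fun i => if i == j then n i : tropZ else 1)).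
  by rewrite -big_mkcond big_pred1_eq ffunE.
move=> i _; rewrite (ghomz fM) [LHS]tropZ_expgz /f ffunE eq_sym.
by case: eqP => _; [apply: mul1r | apply: mul0r].
Qed.

Let generic_walk ks : generic chi v (walk chi s0 ks).
Proof.
elim/last_ind: ks => [//|ks k IHks]; rewrite -cats1 walk_cat.
exact: generic_mut.
Qed.

Local Notation xs ks := (sx (walk chi s0 ks)).

(** The tropical point where the variable at [i'] has value plus or minus the
    [i']-th basis vector, at the cluster reached by [ls], measures the lowest and
    the highest degree in each variable. Write the Laurent polynomial [f] as a
    quotient of positive sums: their extreme degrees are tropical values, and
    extreme degrees are additive because the group ring is a domain. Hence all
    degrees of [f] are those of the single variable [x_i]. *)
Lemma expansion_degrees ks j ls i f :
  (forall a, sx (trop_walk a B ks) j = sx (trop_walk a B ls) i) ->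
  v (xs ks j) = rho (xs ls) f ->
  {in supp f, forall g, g.2 = texp (fun r => (r == i)%:R%R)}.
Proof.
move=> trop_eq fE.
have [l [l' [l0 l'0 ll']]] : positive_expansion chi (xs ls) (xs ks j).
  rewrite -[walk chi s0 ks](_ : walk chi (walk chi s0 ls) (rev ls ++ ks) = _).
    exact: walk_positive.
  by rewrite walk_cat walkK.
have rho_ev l1 : l1 != [::] -> rho (xs ls) (gsum l1) = v (ev (mon chi (xs ls)) l1).
  rewrite /rho lin_gsum; elim: l1 => [//|g l1 IHl1] _; rewrite big_cons.
  have [->|l10] := eqVneq l1 [::]; first by rewrite big_nil addr0 ev1.
  by rewrite -cat1s ev_cat // vD ev1 IHl1.
have fl : (f * gsum l' = gsum l)%R.
  apply: (generic_inj (generic_walk ls)).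
  by rewrite rhoM // -fE !rho_ev // -vM ll'.
have degree (sg : int) r : {in supp f, forall g : monom coef m,
    (sg * (r == i)%:R <= sg * (g.2 r : int))%R}.
  pose a' (i' : 'I_m) : trop m := texp (fun r' => (sg * (r' == i')%:R)%R).
  pose a := trop_back a' B ls.
  pose h : S -> trop m := specialize (@idfun (trop m)) (fun=> 1) a.
  have chi'M : ghom (@idfun (trop m)) by [].
  have h_hom : sfhom h by apply: specialize_hom; [|apply: const1_hom].
  have hX ks' i' : h (xs ks' i') = sx (trop_walk a B ks') i'.
    have := @specialize_walk _ _ _ e _ _ idfun (fun=> 1) a chi'M (const1_hom m coef)
      coef_y B ks'.
    by rewrite /trop_walk => <-.
  have hXls i' : h (xs ls i') = a' i' by rewrite hX trop_backK.
  have h_chi p : h (chi p) = 1 by apply: (specialize_chi e a chi'M (const1_hom m coef)).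
  pose d (g : monom coef m) : int := (sg * (g.2 r : int))%R.
  have h_mon g : ((h \o mon chi (xs ls)) g r = d g :> int)%R.
    pose pr (t : trop m) : tropZ := t r.
    have prM : ghom pr by move=> t t'; rewrite /pr ffunE.
    rewrite /= /mon h_hom.1 h_chi mul1g (ghom_prod h_hom.1).
    rewrite -[LHS]/(pr _) (ghom_prod prM).
    rewrite (eq_bigr (fun i' => if i' == r then d g : tropZ else 1)) => [|i' _].
      by rewrite -big_mkcond big_pred1_eq.
    rewrite (ghomz h_hom.1) (ghomz prM) hXls [LHS]tropZ_expgz /pr ffunE eq_sym /d.
    case: eqP => [->|_]; first by rewrite mulr1.
    by rewrite mulr0 mul0r.
  have hll' : (((a' i r : int) + (ev (h \o mon chi (xs ls)) l' r : int))
      = (ev (h \o mon chi (xs ls)) l r : int))%R.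
    rewrite !(ev_comp _ h_hom) // -ll' h_hom.1 hX trop_eq -hX hXls.
    by rewrite -trop_mulE.
  have [[g0 g0l' g0E] l'P] := ev_tropP (h \o mon chi (xs ls)) r l'0.
  have [_ lP] := ev_tropP (h \o mon chi (xs ls)) r l0.
  have supp_gsum l1 g : g \in supp (gsum l1) -> g \in l1.
    rewrite -mcoeff_neq0 coeff_gsum; apply: contraR => /count_memPn->.
    by rewrite eqxx.
  have dM : forall g g', d (g * g') = (d g + d g')%R.
    by move=> g g'; rewrite /d trop_mulE mulrDr.
  have -> : (sg * (r == i)%:R)%R = ((ev (h \o mon chi (xs ls)) l r : int)
      - (ev (h \o mon chi (xs ls)) l' r : int))%R.
    by rewrite -hll' addrK ffunE.
  apply: (min_degree_quotient dM fl).
  - exists g0; last by rewrite -h_mon.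
    rewrite -mcoeff_neq0 coeff_gsum pnatr_eq0 -lt0n -has_count has_pred1 //.
  - by move=> g' /supp_gsum /l'P; rewrite h_mon.
  - by move=> g' /supp_gsum /lP; rewrite h_mon.
move=> g gf; apply/ffunP => r; rewrite ffunE.
have := degree 1%R r g gf; have := degree (-1)%R r g gf.
rewrite !mulN1r !mul1r lerN2 => H1 H2; apply/eqP; rewrite eq_le.
by apply/andP.
Qed.

(** A Laurent polynomial with all its degrees those of [x_i] is [x_i] times an
    element of the group ring of the coefficients. *)
Lemma coefficient_ratio ks j ls i :
  (forall a, sx (trop_walk a B ks) j = sx (trop_walk a B ls) i) ->
  exists2 f : group_ring (monom coef m), {in supp f, forall g : monom coef m, g.2 = 1}
    & v (xs ks j) = (rho (xs ls) f * v (xs ls i))%R.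
Proof.
move=> trop_eq.
have [f fE] : laurent chi v (xs ls) (v (xs ks j)).
  rewrite -[walk chi s0 ks](_ : walk chi (walk chi s0 ls) (rev ls ++ ks) = _).
    exact: laurent_phenomenon.
  by rewrite walk_cat walkK.
have f_deg := expansion_degrees trop_eq fE.
pose u : monom coef m := var_exp coef i.
exists (f * group_ring_of (u^-1)%g)%R => [g|].
  move=> /suppM[g1 /f_deg g1E [g2 g2u ->]].
  have -> : g2 = u^-1.
    by apply/eqP; apply: contraLR g2u => g2u; rewrite -mcoeff_neq0 coeff_group_ring_of
      [_ == g2]eq_sym (negbTE g2u).
  by rewrite -[LHS]/(g1.2 * (u.2)^-1) g1E mulgV.
rewrite fE -(mon_var chiM (xs ls) i) -rho_of -rhoM // -mulrA -group_ring_ofM mulVg.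
by rewrite [group_ring_of 1](_ : _ = 1%R) // mulr1.
Qed.

(** Both ratios of the two variables are coefficients, inverse to each other,
    hence monomials by the structure of the units; and no nontrivial monomial
    is possible because the specialization that is the identity on
    coefficients and sends the initial cluster to [1] sends every cluster
    variable to [1]. *)
Theorem tropical_eq_generic ks j ls i :
  (forall a, sx (trop_walk a B ks) j = sx (trop_walk a B ls) i) ->
  xs ks j = xs ls i.
Proof.
move=> trop_eq.
have [f f1 fE] := coefficient_ratio trop_eq.
have [f' f'1 f'E] := coefficient_ratio (fun a => esym (trop_eq a)).
have ff' : (f * f' = 1)%R.
  apply: (generic_inj (generic_walk ls)); rewrite rhoM // rho1 //.
  rewrite (rho_const chi v (xs ls) (xs ks) f'1).
  apply: (mulIf (pf_val_neq0 (xs ks j))); rewrite mul1r -/v.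
  by rewrite -[LHS]mulrA -f'E -fE.
have [g fg cc'] := group_ring_unit_monomial ff'.
have fU : f = mkmalgU g (coeff g f) by rewrite {1}[f]group_ringE fg big_seq_fset1.
have g1 : g.2 = 1 by apply: f1; rewrite fg in_fset1.
have XE : v (xs ks j) = ((coeff g f)%:~R * v (chi g.1 * xs ls i)%g)%R.
  rewrite fE fU vM mulrA; congr (_ * _)%R; rewrite rhoU mcoeffUU.
  congr (_ * v _)%R; rewrite /mon g1 big1 ?mulg1 // => r _; by rewrite ffunE.
have c1 : coeff g f = 1%R.
  have : ((coeff g f == 1) || (coeff g f == -1))%R.
    have /eqP : (absz (coeff g f) * absz (coeff (g^-1) f') = 1)%N by rewrite -abszM cc'.
    rewrite muln_eq1 => /andP[/eqP]; move: (coeff g f) => c; lia.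
  case/orP => /eqP cE; first exact: cE.
  (* The sum of two positive elements is not zero. *)
  have /eqP[] := v_neq0 vM v1 (xs ks j (+) chi g.1 * xs ls i).
  by rewrite vD XE cE mulN1r addNr.
have {}XE : xs ks j = chi g.1 * xs ls i.
  by apply: pf_val_inj; rewrite -/(v _) XE c1 mul1r.
pose eps : S -> coef := specialize (@idfun coef) idfun (fun=> 1).
have idM : ghom (@idfun coef) by [].
have epsX ks' i' : eps (xs ks' i') = 1.
  have /(congr1 (fun s => sx s i')) E :=
    specialize_walk e (fun=> 1) idM (id_hom coef) coef_y B ks'.
  by apply: etrans E _; rewrite walk_one.
have eps_hom : sfhom eps := specialize_hom e (fun=> 1) idM (id_hom coef).
have eps_chi p : eps (chi p) = p := specialize_chi e (fun=> 1) idM (id_hom coef) p.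
rewrite XE; have := congr1 eps XE; rewrite eps_hom.1 !epsX eps_chi mulg1 => <-.
by rewrite (ghom1 chiM) mul1g.
Qed.

End GenericCoefficients.

(** * The given seed as a free seed *)

Section FreeGenerating.
Import mpoly.
Variables (P : semifieldType) (F : fieldType) (iota : {rmorphism coeff_field P -> F}).
Variables (m : nat) (x : 'I_m -> F).
Hypothesis x_free : free_generating iota x.
Local Open Scope ring_scope.

Local Notation mm := (mpoly.mmap iota x).

Let x_neq0 i : x i != 0.
Proof.
apply/eqP => xi0; have [x_indep _] := x_free.
pose p : mpoly.mpoly m (coeff_field P) := mpoly.mpolyX (coeff_field P) (mpoly.mnm1 i).
have /x_indep/(congr1 (mpoly.mcoeff (mpoly.mnm1 i))) : mm p = 0.
  by rewrite mpoly.mmapX mpoly.mmap1U.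
by rewrite mpoly.mcoeffX mpoly.mcoeff0 eqxx => /eqP; rewrite oner_eq0.
Qed.

Definition seed_emb (g : monom P m) : F :=
  semifield_embed iota g.1 * \prod_i x i ^ (g.2 i : int).

Lemma semifield_embedM p p' :
  semifield_embed iota (p * p')%g = semifield_embed iota p * semifield_embed iota p'.
Proof. by rewrite /semifield_embed group_ring_ofM !rmorphM. Qed.

Lemma semifield_embed1 : semifield_embed iota 1%g = 1.
Proof. by rewrite /semifield_embed [group_ring_of _](_ : _ = 1) // !rmorph1. Qed.

Lemma seed_embM g g' : seed_emb (g * g')%g = seed_emb g * seed_emb g'.
Proof.
rewrite /seed_emb semifield_embedM mulrACA -big_split; congr (_ * _).
by apply: eq_bigr => i _; rewrite /= -expfzDr // -trop_mulE.
Qed.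

(** Shifting all exponents by the same large [N] turns a relation between
    Laurent monomials into one between monomials. *)
Lemma seed_emb_inj : injective (lin seed_emb).
Proof.
suff inj0 f : lin seed_emb f = 0 -> f = 0.
  move=> f f' ff'; apply/eqP; rewrite -subr_eq0; apply/eqP/inj0.
  by rewrite linB ff' subrr.
move=> f0; apply/eqP/negPn/negP => /supp_neq0[g0 g0f].
have [x_indep _] := x_free; pose N := expbound f.
pose mnm (g : monom P m) : mpoly.multinom m :=
  mpoly.Multinom [tuple absz ((g.2 i : int) + N%:Z) | i < m].
have mnmE g i : g \in monalg.msupp f ->
    (mpoly.fun_of_multinom (mnm g) i)%:Z = ((g.2 i : int) + N%:Z)%R :> int.
  by move=> gf; rewrite /mnm mpoly.mnmE gez0_abs //; apply: expboundP.
pose c g : coeff_field P := (monalg.mcoeff g f)%:~R * FracField.tofrac (group_ring_of g.1).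
pose p : mpoly.mpoly m (coeff_field P) :=
  \sum_(g <- monalg.msupp f) c g *: mpoly.mpolyX (coeff_field P) (mnm g).
have p0 : p = 0.
  apply: x_indep; rewrite /p raddf_sum /=.
  transitivity (lin seed_emb f * \prod_i x i ^+ N); last by rewrite f0 mul0r.
  rewrite /lin monalg.mmapE mulr_suml big_seq [RHS]big_seq.
  apply: eq_bigr => g gf; rewrite mpoly.mmapZ mpoly.mmapX rmorphM rmorph_int.
  rewrite /seed_emb -!mulrA; congr (_ * (_ * _)); rewrite -big_split.
  apply: eq_bigr => i _ /=.
  by rewrite -[LHS]/(x i ^ (mpoly.fun_of_multinom (mnm g) i)%:Z) mnmE // expfzDr.
pose h : group_ring P :=
  \sum_(g <- monalg.msupp f | mnm g == mnm g0) mkmalgU g.1 (monalg.mcoeff g f).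
have h0 : h = 0.
  apply/eqP; rewrite -tofrac_eq rmorph0.
  have := congr1 (mpoly.mcoeff (mnm g0)) p0; rewrite mpoly.mcoeff0 => <-.
  rewrite /p /h rmorph_sum (raddf_sum (mpoly.mcoeff (mnm g0))) big_mkcond.
  apply/eqP/eq_bigr => g _ /=; rewrite mpoly.mcoeffZ mpoly.mcoeffX.
  case: eqP => _; last by rewrite mulr0.
  by rewrite mulr1 /c mkmalgU_int rmorphMz mulrzl.
have := congr1 (monalg.mcoeff g0.1) h0; rewrite monalg.mcoeff0 coeff_sum big_mkcond.
rewrite (bigD1_seq g0) ?fset_uniq //= eqxx monalg.mcoeffUU big_seq_cond big1 ?addr0.
  by move/eqP; rewrite monalg.mcoeff_eq0 g0f.
move=> g /andP[gf gg0]; case: eqP => // gmnm; rewrite monalg.mcoeffU.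
case: eqP => // g1; case/eqP: gg0; rewrite [LHS]surjective_pairing g1.
rewrite [RHS]surjective_pairing; congr pair; apply/ffunP => i.
apply: (@addIr int N%:Z); rewrite -[LHS](mnmE _ _ gf) -[RHS](mnmE _ _ g0f).
by rewrite gmnm.
Qed.

Definition seed_embedding := Embedding seed_embM seed_emb_inj.

Variables (y : 'I_m -> P) (B : 'M[int]_m).

Let s0 : sseed P (posfrac seed_embedding) m := free_seed seed_embedding y B.

Lemma pf_val_chi p :
  pf_val (free_chi seed_embedding p) = semifield_embed iota p.
Proof.
rewrite /free_chi pf_val_emb -[LHS]/(seed_emb _) /seed_emb big1 ?mulr1 // => i _.
by rewrite ffunE.
Qed.

Lemma pf_val_var i : pf_val (free_var seed_embedding i) = x i.
Proof.
rewrite pf_val_emb -[LHS]/(seed_emb _) /seed_emb semifield_embed1 mul1r.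
rewrite (bigD1 i) //= ffunE eqxx big1 ?mulr1 // => j /negbTE ji.
by rewrite ffunE ji.
Qed.

Lemma pf_valX (a : posfrac seed_embedding) (n : int) :
  pf_val (a ^z n)%g = pf_val a ^ n.
Proof.
have E k : pf_val (a ^+ k)%g = pf_val a ^+ k.
  by elim: k => [|k IHk]; rewrite ?pf_val1 // expgS exprS pf_valM IHk.
by case: n => n; [apply: E | rewrite /= pf_valV E].
Qed.

Lemma pf_val_prod (E : 'I_m -> posfrac seed_embedding) :
  pf_val (\prod_i E i)%g = \prod_i pf_val (E i).
Proof. exact: (big_morph _ (@pf_valM _ _ _) (pf_val1 _)). Qed.

Definition to_seed (s : sseed P (posfrac seed_embedding) m) : seed P F m :=
  Seed (fun i => pf_val (sx s i)) (sy s) (sB s).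

Lemma mutate_to_seed s k :
  mutate iota (to_seed s) k = to_seed (smut (free_chi seed_embedding) s k).
Proof.
rewrite /mutate /to_seed; congr Seed.
- apply/funext => j; rewrite /mutate_x /= /mutx; case: eqP => // _.
  rewrite pf_valM pf_valV pf_valM pf_valD pf_valM !pf_val_prod !pf_val_chi.
  by congr ((_ * _ + _) / _); apply: eq_bigr => i _; rewrite pf_valX.
- by apply/matrixP => i j; rewrite !mxE pos_partE.
Qed.

Lemma foldl_mutate ks :
  foldl (fun t k => mutate iota t k) (Seed x y B) ks
    = to_seed (walk (free_chi seed_embedding) s0 ks).
Proof.
have -> : Seed x y B = to_seed s0.
  by rewrite /to_seed /=; congr Seed; apply/funext => i; rewrite pf_val_var.
by elim: ks s0 => [//|k ks IHks] s; rewrite /= mutate_to_seed IHks.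
Qed.

End FreeGenerating.

(** * Independence of the coefficients *)

(** Equality passes from [P] to the tropical semifield, from there to the
    coefficients [P'] with principal coefficients adjoined, and then to [P']
    by forgetting the latter. *)
Lemma free_eq_transfer (m : nat) (B : 'M[int]_m) (P P' : semifieldType) (F F' : fieldType)
    (e : embedding (monom P m) F) (e' : embedding (monom P' m) F')
    (y : 'I_m -> P) (y' : 'I_m -> P') ks i ls j :
  (B^T = - B)%R ->
  sx (walk (free_chi e) (free_seed e y B) ks) i
    = sx (walk (free_chi e) (free_seed e y B) ls) j ->
  sx (walk (free_chi e') (free_seed e' y' B) ks) i
    = sx (walk (free_chi e') (free_seed e' y' B) ls) j.
Proof.
move=> BT E.
have trop_eq a : sx (trop_walk a B ks) i = sx (trop_walk a B ls) j.
  exact: (specialize_eq a (chi' := @idfun (trop m)) _ (const1_hom m P) E).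
have gen_eq := tropical_eq_generic y' BT (frac_embedding (monom (coef P' m) m)) trop_eq.
have fst_hom : sfhom (fst : coef P' m -> P') by [].
exact: (specialize_eq (free_var e') (@free_chiM _ _ _ e') fst_hom gen_eq).
Qed.

Section ClusterComplexes.
Variables (P : semifieldType) (F : fieldType) (iota : {rmorphism coeff_field P -> F}).
Variables (m : nat) (s0 : seed P F m).

Definition cluster_var ks i := seed_x (foldl (fun t k => mutate iota t k) s0 ks) i.

Lemma vertexP z :
  vertices (cluster_complex iota s0) z <-> exists ks i, z = cluster_var ks i.
Proof.
split=> [[C [s [ks sE] CE]]|[ks [i ->]]].
  by rewrite CE sE => /imfsetP[i _ ->]; exists ks, i.
exists [fset seed_x (foldl (fun t k => mutate iota t k) s0 ks) i | i in 'I_m]%fset.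
  by exists (foldl (fun t k => mutate iota t k) s0 ks) => //; exists ks.
by apply/imfsetP; exists i.
Qed.

Lemma simplexP (C : {fset F}) : simplex (cluster_complex iota s0) C <->
  exists ks, forall z, z \in C -> exists i, z = cluster_var ks i.
Proof.
split=> [[D [s [ks sE] DE]]|[ks Cks]].
  by rewrite DE sE => /fsubsetP Cks; exists ks => z /Cks /imfsetP[i _ ->]; exists i.
exists [fset seed_x (foldl (fun t k => mutate iota t k) s0 ks) i | i in 'I_m]%fset.
  by exists (foldl (fun t k => mutate iota t k) s0 ks) => //; exists ks.
by apply/fsubsetP => z /Cks[i ->]; apply/imfsetP; exists i.
Qed.

End ClusterComplexes.

(** The map that keeps the index of each variable is well defined and injective by
    hypothesis, and it takes clusters to clusters since these are the sets of
    variables whose index has a given word. *)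
Lemma cluster_complex_iso m (P P' : semifieldType) (F F' : fieldType)
    (iota : {rmorphism coeff_field P -> F}) (iota' : {rmorphism coeff_field P' -> F'})
    (s : seed P F m) (s' : seed P' F' m) :
  (forall ks i ls j, cluster_var iota s ks i = cluster_var iota s ls j <->
     cluster_var iota' s' ks i = cluster_var iota' s' ls j) ->
  sc_isomorphic (cluster_complex iota s) (cluster_complex iota' s').
Proof.
move=> same.
have /choice[phi phiP] z : exists z', forall ks i,
    z = cluster_var iota s ks i -> z' = cluster_var iota' s' ks i.
  have [[ks [i zE]]|no] := pselect (exists ks i, z = cluster_var iota s ks i).
    by exists (cluster_var iota' s' ks i) => ls j; rewrite zE => /same.
  by exists 0%R => ks i zE; case: no; exists ks, i.
have phiE ks i : phi (cluster_var iota s ks i) = cluster_var iota' s' ks i.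
  exact: phiP.
exists phi; split; first split.
- by move=> _ /vertexP[ks [i ->]] /=; apply/vertexP; exists ks, i; rewrite phiE.
- move=> z z'; rewrite !classical_sets.in_setE => /vertexP[ks [i ->]] /vertexP[ls [j ->]].
  by rewrite !phiE => /same.
- move=> _ /vertexP[ks [i ->]]; exists (cluster_var iota s ks i) => //.
  by apply/vertexP; exists ks, i.
move=> C Cv; split=> /simplexP[ks Cks]; apply/simplexP; exists ks.
  by move=> _ /imfsetP[z /= /Cks[i ->] ->]; exists i.
move=> z zC; have /vertexP[ls [j zE]] := Cv z zC.
have [|i] := Cks (phi z); first by apply/imfsetP; exists z.
by rewrite zE phiE => /same->; exists i.
Qed.

Local Open Scope ring_scope.

Theorem corollary5p6 (m : nat) (B : 'M[int]_m)
    (P P' : semifieldType) (F F' : fieldType)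
    (iota : {rmorphism coeff_field P -> F})
    (iota' : {rmorphism coeff_field P' -> F'})
    (x : 'I_m -> F) (y : 'I_m -> P) (x' : 'I_m -> F') (y' : 'I_m -> P') :
  is_seed iota (Seed x y B) -> is_seed iota' (Seed x' y' B) ->
  sc_isomorphic (cluster_complex iota (Seed x y B))
                (cluster_complex iota' (Seed x' y' B)).
Proof.
move=> [/= x_free BT] [/= x'_free _]; apply: cluster_complex_iso => ks i ls j.
rewrite /cluster_var !(foldl_mutate x_free) !(foldl_mutate x'_free) /=.
by split=> /pf_val_inj E; congr pf_val; apply: free_eq_transfer E.
Qed.
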